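(* For every $d\ge3$ there exists a copula $C\in\mathcal{C}^d_{\rm c}$ with $d_\infty(C,\psi(C))\ge\frac18$; in particular $\sup_{C\in\mathcal{C}^d_{\rm c}}d_\infty(C,\psi(C))\ge\frac18$.
   Context: $\mathbb{I}=[0,1]$, $\lambda$ Lebesgue measure, $d_\infty$ the uniform distance between $d$-dimensional copulas. For a $d$-dimensional copula $C$ and $J\subseteq\{1,\dots,d\}$, $C_J$ is the marginal copula of the coordinates in $J$ and $\mu_{C_J}$ its measure. For $J$ with $|J|\ge2$ and $\emptyset\ne L\subseteq J$ with $|L|\le|J|-2$, $F_{j|L}(\cdot|\mathbf{t})$ ($j\in J\setminus L$) denote the univariate conditional distribution functions of coordinate $j$ given the coordinates in $L$ equal $\mathbf{t}$ (derived from a regular conditional distribution under $C_J$), and $C^{\mathbf{t}}_{J\setminus L;L}$ the corresponding conditional copula of the coordinates $J\setminus L$ given $\mathbf{t}$ (copula of that conditional distribution). $\mathcal{C}^d_{\rm c}$ is the family of $d$-dimensional copulas for which all these conditional univariate distribution functions are continuous for $\mu_{C_L}$-a.e. $\mathbf{t}$ (so the conditional copulas are a.e. unique). Partial vine copula of D-vine structure: for $C\in\mathcal{C}^d_{\rm c}$ define $C^{\rm PVC}$ recursively. Set $(C^{\rm PVC})_{i,i+1}:=C_{i,i+1}$, $i=1,\dots,d-1$. For $k=2,\dots,d-1$ and $i=1,\dots,d-k$, with $M=\{i+1,\dots,i+k-1\}$: the partial copula $(C_p)_{i,i+k}(a,b):=\int_{\mathbb{I}^{k-1}}C^{\mathbf{w}}_{\{i,i+k\};M}(a,b)\,d\mu_{(C^{\rm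 PVC})_M}(\mathbf{w})$ (for $k=2$, $\mu_{(C^{\rm PVC})_M}=\lambda$), and $(C^{\rm PVC})_{i,\dots,i+k}(u_i,\dots,u_{i+k}):=\int_{\times_{m\in M}[0,u_m]}(C_p)_{i,i+k}\big(F^{\rm PVC}_{i|M}(u_i|\mathbf{t}),F^{\rm PVC}_{i+k|M}(u_{i+k}|\mathbf{t})\big)\,d\mu_{(C^{\rm PVC})_M}(\mathbf{t})$, where $F^{\rm PVC}_{i|M}$ and $F^{\rm PVC}_{i+k|M}$ are the conditional univariate distribution functions of coordinate $i$ resp. $i+k$ given the coordinates in $M$, computed from the previously constructed copulas $(C^{\rm PVC})_{i,\dots,i+k-1}$ resp. $(C^{\rm PVC})_{i+1,\dots,i+k}$. Finally $\psi(C):=C^{\rm PVC}=(C^{\rm PVC})_{1,\dots,d}$, defining $\psi:\mathcal{C}^d_{\rm c}\to\mathcal{C}^d_{\rm c}$. *)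

(* Defs.v *)
From HB Require Import structures.
From mathcomp Require Import all_boot all_order all_algebra.
From mathcomp Require Import all_classical all_reals all_analysis.
From mathcomp Require Import measurable_realfun.

Set Implicit Arguments.
Unset Strict Implicit.
Unset Printing Implicit Defensive.

Import Order.TTheory GRing.Theory Num.Theory.
Import numFieldNormedType.Exports.
Local Open Scope classical_set_scope.
Local Open Scope ring_scope.

(* Coordinates are indexed 0,...,n-1 (the paper uses 1,...,d).  A point of  *)
(* R^n is an n-tuple, equipped with the product sigma-algebra of mathcomp-   *)
(* analysis (measurable_tuple).                                             *)

Section Copulas.
Variable R : realType.

Definition coord n (x : n.-tuple R) (i : nat) : R := nth 0 x i.

Definition orthant n (u : n.-tuple R) : set (n.-tuple R) :=
  [set y | forall m : 'I_n, tnth y m <= tnth u m].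

Definition in_cube n (u : n.-tuple R) : Prop :=
  forall m : 'I_n, 0 <= tnth u m <= 1.

Definition box n (S : {set 'I_n}) (u : n.-tuple R) : set (n.-tuple R) :=
  [set x | forall m : 'I_n, m \in S -> tnth x m <= tnth u m].

Definition copula_measure n (Q : probability (n.-tuple R) R) : Prop :=
  forall (m : 'I_n) (a : R), 0 <= a <= 1 ->
    Q [set y | tnth y m <= a] = a%:E.

Definition copula_of n (Q : probability (n.-tuple R) R) (u : n.-tuple R) : R :=
  fine (Q (orthant u)).

Definition dinf n (Q1 Q2 : probability (n.-tuple R) R) : R :=
  sup [set r | exists u, in_cube u /\ r = `|copula_of Q1 u - copula_of Q2 u|].

Definition cdf (Q : probability R R) (a : R) : R := fine (Q [set y | y <= a]).

Definition agree n (L : {set 'I_n}) (x y : n.-tuple R) : Prop :=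
  forall m : 'I_n, m \in L -> tnth x m = tnth y m.

(* A depends only on the coordinates in L; for measurable A this means     *)
(* that A belongs to the sigma-algebra generated by the coordinates in L.  *)
Definition depends_only n (L : {set 'I_n}) (A : set (n.-tuple R)) : Prop :=
  forall x y, agree L x y -> (A x <-> A y).

(* K is a regular conditional distribution of g(X) given the coordinates  *)
(* X_L, where X ~ P: a Markov kernel from R^n (depending only on the       *)
(* L-coordinates, i.e. a kernel from R^L) such that                        *)
(*   P(A /\ g^-1 B) = \int_A K(x, B) dP(x)   for A in sigma(X_L), B Borel. *)
Definition rcd n {dT} {T : measurableType dT} (P : probability (n.-tuple R) R)
    (L : {set 'I_n}) (g : n.-tuple R -> T) (K : n.-tuple R -> probability T R)
    : Prop :=
  [/\ forall x y, agree L x y -> forall B, K x B = K y B,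
      forall B, measurable B -> measurable_fun [set: n.-tuple R] (fun x => K x B : \bar R) &
      forall A B, measurable A -> depends_only L A -> measurable B ->
        P (A `&` g @^-1` B) = (\int[P]_(x in A) K x B)%E].

(* The class C^d_c: for all J with |J| >= 2, all nonempty L \subset J with *)
(* |L| <= |J| - 2 and all j in J \ L, every version of the conditional     *)
(* distribution function of coordinate j given the coordinates in L is     *)
(* continuous for a.e. value of the conditioning variables.  (Conditional  *)
(* distributions under the marginal C_J coincide with those computed from  *)
(* the joint law, since L u {j} \subset J.)                                *)
Definition in_Cc n (mu : probability (n.-tuple R) R) : Prop :=
  copula_measure mu /\
  forall (J L : {set 'I_n}) (j : 'I_n),
    (2 <= #|J|)%N -> L \subset J -> (0 < #|L|)%N -> (#|L| <= #|J| - 2)%N ->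
    j \in J :\: L ->
    forall K : n.-tuple R -> probability R R,
      rcd mu L (fun x => tnth x j) K ->
      {ae mu, forall x, continuous (cdf (K x))}.

Definition blk n (i k : nat) : {set 'I_n} := [set m : 'I_n | (i <= m <= i + k)%N].
Definition mid n (i k : nat) : {set 'I_n} := [set m : 'I_n | (i < m < i + k)%N].

Definition pair2 (a b : R) : 2.-tuple R := [tuple a; b].

(* nu is the partial vine copula (D-vine) psi(mu) of mu.                   *)
(* P i k is a probability measure on R^n whose marginal on the block       *)
(* {i,...,i+k} is (the measure of) (C^PVC)_{i,...,i+k}.                    *)
Definition is_PVC n (mu nu : probability (n.-tuple R) R) : Prop :=
  exists P : nat -> nat -> probability (n.-tuple R) R,
  [/\
   forall i, (i + 1 < n)%N ->
     forall u, P i 1%N (box (blk n i 1) u) = mu (box (blk n i 1) u),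
   forall i k, (2 <= k)%N -> (i + k < n)%N ->
     exists (KL KR : n.-tuple R -> probability R R)
            (Kc Cc : n.-tuple R -> probability (2.-tuple R) R),
     [/\
      rcd (P i k.-1) (mid n i k) (fun x => coord x i) KL,
      rcd (P i.+1 k.-1) (mid n i k) (fun x => coord x (i + k)) KR,
      rcd mu (mid n i k) (fun x => pair2 (coord x i) (coord x (i + k))) Kc,
      (* Cc x is the conditional copula C^x_{i,i+k;M}: a copula (kernel,   *)
      (* depending only on the M-coordinates) satisfying Sklar's identity  *)
      (* with the conditional joint law Kc x and its margins               *)
      (forall x, copula_measure (Cc x)) /\
      (forall x y, agree (mid n i k) x y -> forall B, Cc x B = Cc y B) /\
      (forall B, measurable B -> measurable_fun [set: n.-tuple R] (fun x => Cc x B : \bar R)) /\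
      (forall x a b, Kc x (orthant (pair2 a b)) =
         Cc x (orthant (pair2
            (fine (Kc x [set y | coord y 0 <= a]))
            (fine (Kc x [set y | coord y 1 <= b])))))
      &
      let Cp a b := fine (\int[P i k.-1]_x Cc x (orthant (pair2 a b)))%E in
      forall u, in_cube u ->
        P i k (box (blk n i k) u) =
        (\int[P i k.-1]_(x in box (mid n i k) u)
            (Cp (cdf (KL x) (coord u i)) (cdf (KR x) (coord u (i + k))))%:E)%E],
   copula_measure nu &
   forall u, in_cube u -> nu (orthant u) = P 0%N n.-1 (box [set: 'I_n] u)].

End Copulas.

(* Main.v *)
(** Condition the uniform law on [0,1]^d on the event that an odd number of the
    coordinates 1, 2 and d lie below 1/2.  Any set of coordinates omitting one
    of these three stays independent and uniform, so every copula met in the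
    recursion, except for the pair {1,d} given {2,...,d-1}, is the independence
    copula.  For that pair the conditional copula is one of two opposite parity
    copulas, according to the position of the second coordinate, and averages to
    independence.  Hence the partial vine copula is the product copula, and at
    the point with entries 1/2 in these three coordinates and 1 elsewhere the
    two copulas take the values 1/4 and 1/8. *)
Require Import Defs.
From HB Require Import structures.
From mathcomp Require Import all_boot all_order all_algebra.
From mathcomp Require Import all_classical all_reals all_analysis.
From mathcomp Require Import measurable_realfun.
From mathcomp Require Import lra zify.
Import Order.TTheory GRing.Theory Num.Theory.
Import numFieldNormedType.Exports.
Local Open Scope classical_set_scope.
Local Open Scope ring_scope.

Set Implicit Arguments.
Unset Strict Implicit.

(** The kernels in the recursion are arbitrary versions, so what is known of them holds only almost
    everywhere, and for different laws: two intermediate laws for the conditional margins, the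
    original law for the conditional pair. Null sets pass between these laws because the exceptional
    sets depend only on the conditioning coordinates, on which all the laws are uniform. To show
    that every partial vine copula is the product copula, no conditional copula is computed. The
    conditional margins are a.e. uniform, so by Sklar's identity the conditional copula agrees with
    the conditional law; averaging that law gives back the law of the pair, which is uniform because
    two coordinates cannot contain three. The explicit parity copulas enter only in showing that a
    partial vine copula exists. Parity of coordinates 1 and d alone would leave the conditional
    copula constant, and averaging would lose nothing; coordinate 2 makes it vary. Conditioning
    gives density 2, which yields both the continuity of the conditional distribution functions and
    the factor between 1/4 and 1/8. *)

Section MeasurableFunOf.
Context {d1 d2 : measure_display} {T1 : measurableType d1} {T2 : measurableType d2}.

Definition mfun_of (f : T1 -> T2) (mf : measurable_fun setT f) : {mfun T1 >-> T2} :=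
  HB.pack f (isMeasurableFun.Build _ _ _ _ f mf).

End MeasurableFunOf.

(** * Orthants as a generating family, and sets that depend on few coordinates *)

Section Orthants.
Context {R : realType}.
Implicit Types n : nat.

Lemma measurable_tnth_preim n (i : 'I_n) (B : set R) : measurable B ->
  measurable [set x : n.-tuple R | B (tnth x i)].
Proof. by move=> mB; have := @measurable_tnth _ R n i measurableT B mB; rewrite setTI. Qed.

Lemma measurable_le_ray (a : R) : measurable [set y : R | y <= a].
Proof. by rewrite -set_itvNyc. Qed.

Definition rect n (B : 'I_n -> set R) : set (n.-tuple R) :=
  [set x | forall i, B i (tnth x i)].

Lemma measurable_rect n (B : 'I_n -> set R) :
  (forall i, measurable (B i)) -> measurable (rect B).
Proof.
move=> mB; rewrite (_ : rect B = \bigcap_i [set x | B i (tnth x i)]).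
  apply: fin_bigcap_measurable => // i _; exact: measurable_tnth_preim.
by apply/seteqP; split => x h i; [move=> _; exact: h|exact: (h i)].
Qed.

Lemma measurable_box n (S : {set 'I_n}) (u : n.-tuple R) : measurable (box S u).
Proof.
rewrite (_ : box S u =
  rect (fun i => if i \in S then [set y | y <= tnth u i] else setT)).
  by apply: measurable_rect => i; case: ifP => // _; exact: measurable_le_ray.
apply/seteqP; split => x /= h i; first by case: ifP => //; exact: h.
by move=> iS; have := h i; rewrite iS.
Qed.

Lemma box_setT n (u : n.-tuple R) : box [set: 'I_n] u = orthant u.
Proof. by apply/seteqP; split => x /= h i //; apply: h; rewrite inE. Qed.

Lemma measurable_orthant n (u : n.-tuple R) : measurable (orthant u).
Proof. by rewrite -box_setT; exact: measurable_box. Qed.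

Let ngen n := [set A | exists u : n.-tuple R, A = orthant u].

Let nbox n (k : nat) : n.-tuple R := [tuple of nseq n k%:R].

Let nbox_cover n (x : n.-tuple R) : exists k, forall i, tnth x i <= k%:R.
Proof.
exists (\max_(i < n) Num.truncn (tnth x i)).+1 => i.
rewrite (le_trans (ltW (truncnS_gt _)))// ler_nat ltnS.
exact: leq_bigmax.
Qed.

(** Half spaces generate, and the half space where coordinate [i] exceeds [a] is the complement of a
    countable union of orthants with bound [a] at [i] and [k] elsewhere. *)
Lemma measurable_tuple_orthant n :
  measurable = <<s [set A | exists u : n.-tuple R, A = orthant u] >>.
Proof.
rewrite eqEsubset; split; last first.
  apply: smallest_sub; first exact: sigma_algebra_measurable.
  by move=> _ [u ->]; exact: measurable_orthant.
apply: smallest_sub; first exact: smallest_sigma_algebra.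
move=> A; rewrite -bigcup_seq => -[i _] [B mB <-].
rewrite setTI.
suff : @measurable _ R `<=` image_set_system setT
    (fun x : n.-tuple R => tnth x i) <<s @ngen n >>.
  by move=> /(_ B mB); rewrite /image_set_system/= setTI.
rewrite [X in X `<=` _]RGenOInfty.measurableE; apply: smallest_sub.
  by apply: sigma_algebra_image; exact: smallest_sigma_algebra.
move=> _ [a ->]; rewrite /image_set_system/= setTI.
rewrite (_ : _ @^-1` _ = setT `\` \bigcup_k
   orthant [tuple if m == i then a else k%:R | m < n]).
  apply: sigma_algebraCD; apply: sigma_algebra_bigcup => k.
  by apply: sub_sigma_algebra; eexists.
rewrite setTD -setCitvl preimage_setC; congr (~` _); apply/seteqP; split => x /=.
  rewrite in_itv/= => xa; have [k hk] := nbox_cover x.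
  by exists k => // m; rewrite tnth_mktuple; case: eqP => [->|].
by move=> [k _ /(_ i)]; rewrite tnth_mktuple eqxx in_itv.
Qed.

(** Orthants are closed under intersection, and those with constant bound [k] exhaust the space, so
    uniqueness of measures applies. *)
Lemma measure_eq_orthant n (m1 m2 : {measure set (n.-tuple R) -> \bar R}) :
  (m1 setT < +oo)%E -> (forall u, m1 (orthant u) = m2 (orthant u)) ->
  forall A, measurable A -> m1 A = m2 A.
Proof.
move=> m1T m12; apply: (measure_unique (@ngen n) (fun k => orthant (nbox n k))).
- exact: measurable_tuple_orthant.
- move=> _ _ [u ->] [v ->].
  exists [tuple Num.min (tnth u i) (tnth v i) | i < n].
  apply/seteqP; split => x.
    by move=> [hu hv] i; rewrite tnth_mktuple le_min hu hv.
  by move=> h; split => i; have := h i; rewrite tnth_mktuple le_min => /andP[].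
- by move=> i; eexists.
- rewrite -subTset => x _; have [k hk] := nbox_cover x.
  by exists k => // i; rewrite tnth_nseq.
- by move=> _ [u ->].
- move=> k; rewrite (le_lt_trans _ m1T)//.
  by apply: le_measure; rewrite ?inE//; exact: measurable_orthant.
Qed.

Lemma measure_eq_orthant_preim {d} {T : measurableType d} n
    (m1 m2 : {measure set T -> \bar R}) (f : T -> n.-tuple R) :
  measurable_fun setT f -> (m1 setT < +oo)%E ->
  (forall u, m1 (f @^-1` orthant u) = m2 (f @^-1` orthant u)) ->
  forall A, measurable A -> m1 (f @^-1` A) = m2 (f @^-1` A).
Proof.
move=> mf m1T m12 A mA.
exact: (measure_eq_orthant (m1 := pushforward m1 (mfun_of mf))
  (m2 := pushforward m2 (mfun_of mf))).
Qed.

(** A set that depends only on [L] is its own preimage under this map, so uniqueness on the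
    sigma-algebra of the coordinates in [L] reduces to uniqueness of image measures. *)
Definition keep n (L : {set 'I_n}) (x : n.-tuple R) : n.-tuple R :=
  [tuple if i \in L then tnth x i else 0 | i < n].

Lemma tnth_keep n (L : {set 'I_n}) x i :
  tnth (keep L x) i = if i \in L then tnth x i else 0.
Proof. by rewrite tnth_mktuple. Qed.

Lemma agree_keep n (L : {set 'I_n}) x : agree L x (keep L x).
Proof. by move=> i iL; rewrite tnth_keep iL. Qed.

Lemma measurable_keep n (L : {set 'I_n}) : measurable_fun setT (keep L).
Proof.
apply/measurable_fun_tnthP => i.
rewrite (_ : _ \o _ = fun x => if i \in L then tnth x i else 0).
  by case: (i \in L) => //; exact: measurable_tnth.
by apply/funext => x /=; rewrite tnth_keep.
Qed.

Lemma keep_preim n (L : {set 'I_n}) A : depends_only L A -> keep L @^-1` A = A.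
Proof.
move=> dA; apply/seteqP; split => x /= Ax.
  exact: (proj2 (dA _ _ (@agree_keep _ L x)) Ax).
exact: (proj1 (dA _ _ (@agree_keep _ L x)) Ax).
Qed.

End Orthants.

(** * The uniform law on the unit interval and its finite powers *)

Section UniformLaw.
Context {R : realType}.

(* [R] and [measurableTypeR R], on which the library puts Lebesgue measure,
   carry the same sigma-algebra with different displays. *)
Let toR : measurableTypeR R -> R := idfun.

HB.instance Definition _ := @isMeasurableFun.Build _ _ (measurableTypeR R) R toR
  (@measurable_id _ (measurableTypeR R) setT).

Lemma exists_unif01 : exists P : probability R R,
  forall B : set R, P B = lebesgue_measure (B `&` `[0, 1]%classic).
Proof.
(* The Dirac measure is the value of [mnormalize] for total mass zero or infinity; here the mass is
   1. *)
exists (distribution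
  (mnormalize (mrestr lebesgue_measure (@measurable_itv R `[0, 1]))
     (dirac (0 : measurableTypeR R))) toR) => B.
rewrite /= /mnormalize/= /mrestr/=.
rewrite setTI lebesgue_measure_itv/= lte_fin ltr01 sube0.
by rewrite onee_eq0/= invr1 mule1.
Qed.

Definition unif01 : probability R R := sval (cid exists_unif01).

Lemma unif01E (B : set R) :
  unif01 B = lebesgue_measure (B `&` `[0, 1]%classic).
Proof. exact: (svalP (cid exists_unif01)). Qed.

Lemma unif01_le (a : R) : 0 <= a <= 1 -> unif01 [set y | y <= a] = a%:E.
Proof.
move=> /andP[a0 a1]; rewrite unif01E.
rewrite (_ : _ `&` _ = `[0, a]%classic).
  rewrite lebesgue_measure_itv/= lte_fin; case: ltgtP a0 => // [_ _|<-//].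
  by rewrite sube0.
apply/seteqP; split => x /=; rewrite !in_itv/=; first by move=> [-> /andP[->]].
by move=> /andP[-> xa]; rewrite xa (le_trans xa).
Qed.

Lemma unif01_itv (a b : R) : a <= b -> (unif01 `]a, b]%classic <= (b - a)%:E)%E.
Proof.
move=> ab; rewrite unif01E (@le_trans _ _ (lebesgue_measure `]a, b]%classic))//.
  by apply: le_measure; rewrite ?inE//; exact: measurableI.
by rewrite lebesgue_measure_itv/= lte_fin; case: ltgtP ab => // -> _; rewrite lee_fin subrr.
Qed.

Lemma exists_iid (P : probability R R) n :
  exists Q : probability (n.-tuple R) R, forall B : 'I_n -> set R,
    (forall i, measurable (B i)) ->
    Q (rect B) = (\prod_(i < n) fine (P (B i)))%:E.
Proof.
elim: n => [|n [Q IH]].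
  exists (dirac [tuple]) => B mB; rewrite big_ord0.
  by rewrite [LHS]diracE mem_set// => -[].
pose f (p : R * n.-tuple R) : n.+1.-tuple R := [the n.+1.-tuple R of p.1 :: p.2].
have mf : measurable_fun setT f by exact: measurable_cons.
pose g := mfun_of mf.
pose PQ : probability (R * n.-tuple R)%type R := (P \x Q)%E.
exists (distribution PQ g) => B mB.
rewrite -[LHS]/(PQ (g @^-1` rect B)).
suff <- : B ord0 `*` @rect R n (fun i => B (lift ord0 i)) = g @^-1` rect B.
  rewrite [LHS]product_measure1E//; last exact: measurable_rect.
  rewrite [X in (_ * X)%E]IH// big_ord_recl EFinM fineK//.
  exact: fin_num_measure.
apply/seteqP; split => -[x y]/=.
  move=> [h0 h] i; case: (unliftP ord0 i) => [j ->|->//].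
  by rewrite tnthS; exact: h.
move=> h; split; first exact: (h ord0).
by move=> i; have := h (lift ord0 i); rewrite tnthS.
Qed.

End UniformLaw.

(** * Independence under the uniform law on the cube *)

Section UniformCube.
Context {R : realType}.

Definition ucube n : probability (n.-tuple R) R := sval (cid (exists_iid unif01 n)).

Lemma ucubeE n (B : 'I_n -> set R) : (forall i, measurable (B i)) ->
  ucube n (rect B) = (\prod_(i < n) fine (unif01 (B i)))%:E.
Proof. by rewrite /ucube; case: cid => Q /= h; exact: h. Qed.

Lemma depends_onlyS n (L L' : {set 'I_n}) (A : set (n.-tuple R)) :
  L \subset L' -> depends_only L A -> depends_only L' A.
Proof. by move=> /fintype.subsetP LL' dA x y xy; apply: dA => m /LL'; exact: xy. Qed.

Lemma depends_onlyI n (L : {set 'I_n}) (A B : set (n.-tuple R)) :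
  depends_only L A -> depends_only L B -> depends_only L (A `&` B).
Proof.
by move=> dA dB x y xy; split => -[hA hB]; split;
  [exact/(dA _ _ xy)|exact/(dB _ _ xy)|exact/(dA x y)|exact/(dB x y)].
Qed.

Lemma depends_onlyT n (L : {set 'I_n}) : depends_only L [set: n.-tuple R].
Proof. by []. Qed.

Lemma depends_only_coord n (L : {set 'I_n}) (j : 'I_n) (B : set R) :
  j \in L -> depends_only L [set x : n.-tuple R | B (tnth x j)].
Proof. by move=> jL x y xy /=; rewrite xy. Qed.

Lemma depends_only_box n (S : {set 'I_n}) (u : n.-tuple R) :
  depends_only S (box S u).
Proof. by move=> x y xy; split => h m mS; [rewrite -xy|rewrite xy] => //; exact: h. Qed.

(** Both sides are measures in [A], so they need only be compared on preimages of orthants under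
    [keep], which are rectangles. *)
Lemma ucube_indep n (j : 'I_n) (A : set (n.-tuple R)) (B : set R) :
  measurable A -> depends_only [set~ j] A -> measurable B ->
  ucube n (A `&` [set x | B (tnth x j)]) = (ucube n A * unif01 B)%E.
Proof.
move=> mA dA mB.
have mjB := measurable_tnth_preim j mB.
have p0 : 0 <= fine (unif01 B) by exact: fine_ge0.
pose m2 := mscale (NngNum p0) (ucube n).
have <- : m2 A = (ucube n A * unif01 B)%E.
  by rewrite -[LHS]/((fine (unif01 B))%:E * ucube n A)%E fineK ?fin_num_measure// muleC.
rewrite -[RHS]/(m2 A) -(keep_preim dA).
rewrite -[LHS]/(mrestr (ucube n) mjB (keep [set~ j] @^-1` A)).
apply: measure_eq_orthant_preim => //; first exact: measurable_keep.
  rewrite -[ltLHS]/(ucube n (setT `&` [set x | B (tnth x j)])).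
  by rewrite setTI (@le_lt_trans _ _ 1%E) ?ltry// probability_le1.
move=> u.
(* [keep] puts 0 at [j], so the bound there holds for all points or for none, according to the sign
   of [tnth u j]. *)
pose C i : set R := if i != j then [set y | y <= tnth u i]
  else [set y | 0 <= tnth u i].
have mC i : measurable (C i).
  rewrite /C; case: ifP => _; first exact: measurable_le_ray.
  have [u0|u0] := boolP (0 <= tnth u i).
    by rewrite (_ : [set _ | _] = setT)//; apply/seteqP; split.
  by rewrite (_ : [set _ | _] = set0)//; apply/seteqP; split.
have -> : keep [set~ j] @^-1` orthant u = rect C.
  by apply/seteqP; split => x h i; have := h i; rewrite tnth_keep in_setC1 /C; case: (i != j).
rewrite -[LHS]/(ucube n (rect C `&` [set x | B (tnth x j)])).
rewrite -[RHS]/((fine (unif01 B))%:E * ucube n (rect C))%E muleC.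
pose D i := if i == j then C i `&` B else C i.
have mD i : measurable (D i) by rewrite /D; case: ifP => // _; exact: measurableI.
have -> : rect C `&` [set x | B (tnth x j)] = rect D.
  apply/seteqP; split => x.
    by move=> [h1 h2] i; rewrite /D; case: eqP => [->|_]; [split => //|]; exact: h1.
  move=> h; split => [i|]; last by have := h j; rewrite /D eqxx => -[].
  by have := h i; rewrite /D; case: ifP => // _ [].
rewrite !ucubeE// -EFinM; congr EFin.
rewrite (bigD1 j)//= [in RHS](bigD1 j)//=. rewrite [RHS]mulrAC; congr (_ * _); last first.
  by apply: eq_bigr => i /negPf ij; rewrite /D ij.
rewrite /D eqxx /C eqxx/=.
have [u0|u0] := boolP (0 <= tnth u j).
  have -> : [set _ : R | true] = setT by apply/seteqP; split.
  by rewrite setTI probability_setT mul1r.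
have -> : [set _ : R | false] = set0 by apply/seteqP; split.
by rewrite set0I measure0 mul0r.
Qed.

Lemma ucube_coord n (j : 'I_n) (B : set R) : measurable B ->
  ucube n [set x | B (tnth x j)] = unif01 B.
Proof.
by move=> mB; rewrite -[X in ucube n X]setTI ucube_indep// probability_setT mul1e.
Qed.

Lemma copula_measure_ucube n : copula_measure (ucube n).
Proof.
move=> j a a01; rewrite -unif01_le//.
by apply: (@ucube_coord n j [set y | y <= a]); exact: measurable_le_ray.
Qed.

Lemma ucube_box n (S : {set 'I_n}) (u : n.-tuple R) : in_cube u ->
  ucube n (box S u) = (\prod_(i in S) tnth u i)%:E.
Proof.
move=> uc; rewrite (_ : box S u =
  rect (fun i => if i \in S then [set y | y <= tnth u i] else setT)).
  rewrite ucubeE; last by move=> i; case: ifP => // _; exact: measurable_le_ray.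
  rewrite [in RHS]big_mkcond; congr EFin; apply: eq_bigr => i _.
  by case: (i \in S); [rewrite unif01_le|rewrite probability_setT].
apply/seteqP; split => x h i; first by case: ifP => // iS; exact: h.
by move=> iS; have := h i; rewrite iS.
Qed.

(** The hypothesis covers only bounds in the unit cube. Bound 1 shows that the box below 1 has full
    mass, and bound 0 that no mass lies below 0 in a coordinate of [S]; hence an arbitrary bound can
    be clipped to [0,1]. *)
Lemma eq_ucube_dep n (P : probability (n.-tuple R) R) (S : {set 'I_n}) :
  (forall u, in_cube u -> P (box S u) = ucube n (box S u)) ->
  forall A, measurable A -> depends_only S A -> P A = ucube n A.
Proof.
move=> PU A mA dA; rewrite -(keep_preim dA).
apply: measure_eq_orthant_preim => //; first exact: measurable_keep.
  by apply: (le_lt_trans (probability_le1 P measurableT)); rewrite ltry.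
move=> u.
have [un|] := boolP [forall i, (i \notin S) ==> (0 <= tnth u i)]; last first.
  rewrite negb_forall => /existsP[i]; rewrite negb_imply => /andP[iS ui].
  rewrite (_ : _ @^-1` _ = set0) ?measure0//; apply/seteqP; split => // x /(_ i).
  by rewrite tnth_keep (negPf iS) (negPf ui).
have -> : keep S @^-1` orthant u = box S u.
  apply/seteqP; split => x h i; first by move=> iS; have := h i; rewrite tnth_keep iS.
  rewrite tnth_keep; case: ifPn => iS; first exact: h.
  by move: un => /forallP/(_ i); rewrite iS.
pose one : n.-tuple R := [tuple 1 | i < n].
pose v : n.-tuple R := [tuple Num.max 0 (Num.min (tnth u i) 1) | i < n].
have vc : in_cube v.
  by move=> i; rewrite tnth_mktuple le_max lexx/= ge_max ler01/= ge_min lexx orbT.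
have U1 : ucube n (box S one) = 1%E.
  rewrite ucube_box; last by move=> i; rewrite tnth_mktuple ler01 lexx.
  by rewrite big1// => i _; rewrite tnth_mktuple.
have cap1 (Q : probability (n.-tuple R) R) B : Q (box S one) = 1%E ->
    measurable B -> Q (B `&` box S one) = Q B.
  move=> Q1 mB; have mS := measurable_box S one.
  rewrite [RHS](measureDI Q mB mS) [X in (X + _)%E](_ : _ = 0%E) ?add0e//.
  apply/eqP; rewrite -measure_le0 (@le_trans _ _ (Q (~` box S one)))//.
    apply: le_measure; rewrite ?inE.
    - exact: measurableD.
    - exact: measurableC.
    - by move=> x [].
  by rewrite probability_setC// Q1 subee.
have P1 : P (box S one) = 1%E.
  by rewrite PU// => i; rewrite tnth_mktuple ler01 lexx.
have mu := measurable_box S u.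
rewrite -[LHS]/(P (box S u)) -[RHS]/(ucube n (box S u)).
rewrite -(cap1 P _ P1 mu) -(cap1 _ _ U1 mu).
have sub : box S u `&` box S one `<=` box S v.
  move=> x [h1 h2] i iS; rewrite tnth_mktuple le_max le_min h1//=.
  by have := h2 i iS; rewrite tnth_mktuple => ->; rewrite orbT.
have [up|] := boolP [forall i, (i \in S) ==> (0 <= tnth u i)].
  rewrite (_ : _ `&` _ = box S v) ?PU//; apply/seteqP; split => // x h.
  split => i iS; have := h i iS; rewrite !tnth_mktuple;
    have := forallP up i; rewrite iS/= => ui.
    by rewrite max_r ?le_min ?ui ?ler01// => /andP[].
  by rewrite max_r ?le_min ?ui ?ler01// => /andP[].
rewrite negb_forall => /existsP[i]; rewrite negb_imply -ltNge => /andP[iS ui].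
have Uv : ucube n (box S v) = 0%E.
  rewrite ucube_box// (bigD1 i)//= tnth_mktuple max_l ?mul0r//.
  by rewrite ge_min (ltW ui).
have mI := measurableI _ _ mu (measurable_box S one).
transitivity (0%:E : \bar R); [|apply: esym]; apply/eqP; rewrite -measure_le0.
  rewrite -Uv -PU//; apply: le_measure; rewrite ?inE//; exact: measurable_box.
by rewrite -Uv; apply: le_measure; rewrite ?inE//; exact: measurable_box.
Qed.

End UniformCube.

(** * The uniform law conditioned on a parity *)

Section ParityLaw.
Context {R : realType}.

Definition par n (T : {set 'I_n}) (x : n.-tuple R) : bool :=
  odd #|[set m in T | tnth x m <= 1 / 2]%SET|.

(** The flag absorbs coordinates already fixed: removing a low one from [T] flips [b]. The number of
    low coordinates is odd for [b] false, even for [b] true. *)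
Definition parity_set n (T : {set 'I_n}) (b : bool) : set (n.-tuple R) :=
  [set x | par T x (+) b].

Definition low n (j : 'I_n) : set (n.-tuple R) := [set x | tnth x j <= 1 / 2].

Lemma measurable_low n (j : 'I_n) : measurable (@low n j).
Proof. exact: (measurable_tnth_preim j (measurable_le_ray _)). Qed.

Lemma par0 n (x : n.-tuple R) : par finset.set0 x = false.
Proof.
by rewrite /par (_ : [set m in _ | _]%SET = finset.set0) ?cards0//;
  apply/setP => m; rewrite !inE.
Qed.

Lemma parD1 n (T : {set 'I_n}) t x : t \in T ->
  par T x = (tnth x t <= 1 / 2) (+) par (T :\ t)%SET x.
Proof.
move=> tT; rewrite /par (cardsD1 t) oddD inE tT/= oddb; congr (_ (+) odd _).
by apply: eq_card => m; rewrite !inE andbA.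
Qed.

Lemma parity_setD1 n (T : {set 'I_n}) t b : t \in T ->
  parity_set T b = (parity_set (T :\ t)%SET (~~ b) `&` low t) `|`
                   (parity_set (T :\ t)%SET b `&` ~` low t).
Proof.
move=> tT; apply/seteqP; split => x; rewrite /parity_set /low/= (parD1 _ tT).
  case: (boolP (_ <= _)) => h /= e; [left|right]; split => //.
    by move: e; case: par; case: b.
by case=> -[]; case: (_ <= _) => // h; case: par h; case: b.
Qed.

Lemma measurable_parity_set n (T : {set 'I_n}) b : measurable (parity_set T b).
Proof.
elim: {T}#|T| {-2}T (erefl #|T|) b => [T /eqP|k IH T kT b].
  rewrite cards_eq0 => /eqP -> [].
    rewrite (_ : parity_set _ _ = setT)//; apply/seteqP; split => // x _.
    by rewrite /parity_set/= par0.
  rewrite (_ : parity_set _ _ = set0)//; apply/seteqP; split => // x.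
  by rewrite /parity_set/= par0.
have /card_gt0P[t tT] : (0 < #|T|)%N by rewrite kT.
rewrite (parity_setD1 _ tT).
have mP b' : measurable (parity_set (T :\ t)%SET b').
  by apply: IH; move: kT; rewrite (cardsD1 t) tT => -[].
by apply: measurableU; apply: measurableI => //;
  [|apply: measurableC]; exact: measurable_low.
Qed.

Lemma depends_only_parity_set n (T : {set 'I_n}) b :
  depends_only T (parity_set T b).
Proof.
move=> x y xy; rewrite /parity_set/= /par.
rewrite (_ : [set m in T | tnth x m <= _]%SET = [set m in T | tnth y m <= 1 / 2]%SET)//.
by apply/setP => m; rewrite !inE; case: (boolP (m \in T)) => //= /xy ->.
Qed.

Lemma ucube_low n (j : 'I_n) (A : set (n.-tuple R)) :
  measurable A -> depends_only [set~ j]%SET A ->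
  ucube n (A `&` low j) = (ucube n A * (1 / 2)%:E)%E /\
  ucube n (A `&` ~` low j) = (ucube n A * (1 / 2)%:E)%E.
Proof.
move=> mA dA; have h : ucube n (A `&` low j) = (ucube n A * (1 / 2)%:E)%E.
  rewrite (@ucube_indep _ _ j A [set y | y <= 1 / 2])//; last exact: measurable_le_ray.
  by rewrite unif01_le//; apply/andP; split; lra.
split => //; set c := A `&` ~` low j.
have mc : measurable c.
  by apply: measurableI => //; apply: measurableC; exact: measurable_low.
have : ucube n A = (ucube n c + ucube n (A `&` low j))%E.
  exact: (measureDI _ mA (measurable_low j)).
rewrite h -(fineK (fin_num_measure (ucube n) _ mA)).
rewrite -(fineK (fin_num_measure (ucube n) _ mc)).
by rewrite -!EFinM -EFinD => -[e]; congr EFin; lra.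
Qed.

(** Coordinate [t] is a fair coin independent of [A] and of the parity of the rest, so the full
    parity is a fair coin independent of [A]. *)
Lemma ucube_parity_set n (T : {set 'I_n}) b t (A : set (n.-tuple R)) : t \in T ->
  measurable A -> depends_only [set~ t]%SET A ->
  ucube n (A `&` parity_set T b) = (ucube n A * (1 / 2)%:E)%E.
Proof.
move=> tT mA dA; rewrite (parity_setD1 _ tT) setIUr !setIA.
set B := parity_set _ _; set C := parity_set _ _.
have mB : measurable B by exact: measurable_parity_set.
have mC : measurable C by exact: measurable_parity_set.
have dP b' : depends_only [set~ t]%SET (parity_set (T :\ t)%SET b').
  apply: (depends_onlyS _ (@depends_only_parity_set _ _ _)).
  by apply/fintype.subsetP => m; rewrite !inE => /andP[].
have mAB := measurableI _ _ mA mB; have mAC := measurableI _ _ mA mC.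
have mABl : measurable (A `&` B `&` low t).
  by apply: measurableI => //; exact: measurable_low.
have mACl : measurable (A `&` C `&` ~` low t).
  by apply: measurableI => //; apply: measurableC; exact: measurable_low.
transitivity (ucube n (A `&` B `&` low t) + ucube n (A `&` C `&` ~` low t))%E.
  by apply: measureU => //; apply/seteqP; split => // x [[_ h] [_]].
rewrite (ucube_low mAB (depends_onlyI dA (dP _))).1.
rewrite (ucube_low mAC (depends_onlyI dA (dP _))).2.
rewrite -muleDl//; last by rewrite fin_num_adde_defl// fin_num_measure.
congr (_ * _)%E; rewrite -[RHS](_ : ucube n (A `&` B `|` A `&` C) = _).
  apply: esym; apply: measureU => //.
  apply/seteqP; split => // x [[_ h] [_]]; move: h; rewrite /B /C /parity_set/=.
  by case: par; case: b {B C mB mC mAB mAC mABl mACl}.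
rewrite -setIUr (_ : B `|` C = setT) ?setIT//; apply/seteqP; split => // x _.
by rewrite /B /C /parity_set/=; case: par; case: b {B C mB mC mAB mAC mABl mACl};
  [left|right|right|left].
Qed.

(** The last argument is the value taken when the parity set is null, as for [T] empty and [b]
    false. For nonempty [T] the density is 2 on the parity set. *)
Definition parity_law n (T : {set 'I_n}) (b : bool) : probability (n.-tuple R) R :=
  mnormalize (mrestr (ucube n) (measurable_parity_set T b)) (ucube n).

Arguments parity_law : simpl never.

Lemma parity_lawE n (T : {set 'I_n}) b (A : set (n.-tuple R)) :
  T != finset.set0 -> parity_law T b A = (ucube n (A `&` parity_set T b) * 2%:E)%E.
Proof.
move=> /set0Pn[t tT]; have := @ucube_parity_set n T b t setT tT measurableT.
move=> /(_ (@depends_onlyT _ _ _)); rewrite setTI probability_setT mul1e => h.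
pose m : {measure set (n.-tuple R) -> \bar R} :=
  mrestr (ucube n) (measurable_parity_set T b).
have e : m setT = (1 / 2)%:E by rewrite -h -[in RHS](setTI (parity_set T b)).
rewrite -[LHS]/(mnormalize m (ucube n) A).
rewrite /mnormalize e ifF; last first.
  by apply/negbTE; rewrite negb_or/= eqe gt_eqF.
by rewrite -[m A]/(ucube n (A `&` parity_set T b))/= div1r invrK.
Qed.

Lemma parity_law_indep n (T : {set 'I_n}) b t (A : set (n.-tuple R)) : t \in T ->
  measurable A -> depends_only [set~ t]%SET A -> parity_law T b A = ucube n A.
Proof.
move=> tT mA dA; rewrite parity_lawE; last by apply/set0Pn; exists t.
rewrite (ucube_parity_set _ tT)// -muleA -EFinM (_ : 1 / 2 * 2 = 1) ?mule1//.
by rewrite mul1r mulVf.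
Qed.

Lemma parity_law_dep n (T L : {set 'I_n}) b (A : set (n.-tuple R)) :
  ~~ (T \subset L) -> measurable A -> depends_only L A ->
  parity_law T b A = ucube n A.
Proof.
move=> /fintype.subsetPn[t tT tL] mA dA; apply: (parity_law_indep _ tT) => //.
apply: (depends_onlyS _ dA); apply/fintype.subsetP => m mL.
by rewrite !inE; apply: contraNneq tL => <-.
Qed.

Lemma copula_measure_parity_law n (T : {set 'I_n}) b : (1 < #|T|)%N ->
  copula_measure (parity_law T b).
Proof.
move=> T1 j a a01; rewrite -(copula_measure_ucube j a01).
apply: (@parity_law_dep _ _ [set j]%SET).
- by apply/negP => /subset_leq_card; rewrite cards1 leqNgt T1.
- exact: (measurable_tnth_preim j (measurable_le_ray a)).
- by apply: (@depends_only_coord _ _ _ j [set y | y <= a]); rewrite inE.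
Qed.

(** The factor 2 is the density. If [j] is in [T], then [A] has its uniform mass and discarding the
    parity set costs this factor; otherwise coordinate [j] is independent of [A] and of the parity,
    and the factor is slack. *)
Lemma parity_law_itv n (T : {set 'I_n}) b (j : 'I_n) (A : set (n.-tuple R)) (p q : R) :
  T != finset.set0 -> measurable A -> depends_only [set~ j]%SET A -> p <= q ->
  (parity_law T b (A `&` [set x | (p < tnth x j <= q)%R]) <=
   (2 * (q - p))%:E * parity_law T b A)%E.
Proof.
move=> T0 mA dA pq.
have -> : [set x : n.-tuple R | p < tnth x j <= q] =
    [set x | `]p, q]%classic (tnth x j)].
  by apply/seteqP; split => x /=; rewrite in_itv.
have mpq : measurable (`]p, q]%classic : set R) by exact: measurable_itv.
have mj := measurable_tnth_preim j mpq.
have mE := measurable_parity_set T b.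
have [y hy] : exists y, unif01 `]p, q]%classic = y%:E.
  by exists (fine (unif01 `]p, q]%classic)); rewrite fineK// fin_num_measure.
have yqp : y <= q - p by rewrite -lee_fin -hy; exact: unif01_itv.
have key (B : set (n.-tuple R)) : measurable B ->
    (ucube n B * unif01 `]p, q]%classic * 2%:E <= (2 * (q - p))%:E * ucube n B)%E.
  move=> mB; have : (0 <= ucube n B)%E by [].
  have <- : (fine (ucube n B))%:E = ucube n B by rewrite fineK// fin_num_measure.
  by rewrite hy -!EFinM !lee_fin => B0; nra.
have [jT|jT] := boolP (j \in T).
  rewrite (parity_law_indep _ jT mA dA) parity_lawE//.
  apply: le_trans (key _ mA); rewrite -(ucube_indep mA dA mpq).
  apply: lee_pmul => //; apply: le_measure; rewrite ?inE.
  - by do 2 apply: measurableI => //.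
  - exact: measurableI.
  - by move=> x [].
have mAE := measurableI _ _ mA mE.
have dAE : depends_only [set~ j]%SET (A `&` parity_set T b).
  apply: depends_onlyI => //; apply: (depends_onlyS _ (@depends_only_parity_set _ _ _)).
  by apply/fintype.subsetP => m mT; rewrite !inE; apply: contraNneq jT => <-.
rewrite !parity_lawE// muleA setIAC (ucube_indep mAE dAE mpq).
have := key _ mAE.
have <- : (fine (ucube n (A `&` parity_set T b)))%:E = ucube n (A `&` parity_set T b).
  by rewrite fineK// fin_num_measure//; exact: measurableI.
have : 0 <= fine (ucube n (A `&` parity_set T b)) by exact: fine_ge0.
by rewrite hy -!EFinM !lee_fin => ? ?; nra.
Qed.

End ParityLaw.

(** * Almost sure properties of arbitrary versions of a conditional law *)

Section ConditionalDistributions.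
Context {R : realType} {n : nat} {dT : measure_display} {T : measurableType dT}.
Variables (P Q : probability (n.-tuple R) R) (L : {set 'I_n}).
Variables (g : n.-tuple R -> T) (K : n.-tuple R -> probability T R).
Hypothesis mg : measurable_fun setT g.
Hypothesis rcdK : rcd P L g K.
Hypothesis PQ : forall A, measurable A -> depends_only L A -> P A = Q A.

(* An exceptional set of the form [K x B > c] is determined by the
   coordinates in [L], so it is also null for any law [Q] with the same
   [L]-marginal as [P]. *)
Lemma rcd_le (B : set T) (c : R) : measurable B -> 0 <= c ->
  (forall A, measurable A -> depends_only L A ->
     P (A `&` g @^-1` B) <= c%:E * P A)%E ->
  {ae Q, forall x, (K x B <= c%:E)%E}.
Proof.
case: rcdK => dK mK iK mB c0 hB.
(* The margin forces mass zero: on [D k] the kernel integrates to at least c + 1/(k+1) times the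
   mass, and by hypothesis to at most c times it. *)
pose D k := [set x | ((c + k.+1%:R^-1)%:E <= K x B)%E].
have mD k : measurable (D k).
  by rewrite -[D k]setTI; apply: emeasurable_fun_c_infty => //; exact: mK.
have dD k : depends_only L (D k) by move=> x y xy; rewrite /D/= (dK _ _ xy).
have D0 k : Q (D k) = 0%E.
  have k0 : 0 < k.+1%:R^-1 :> R by rewrite invr_gt0.
  rewrite -(PQ (mD k) (dD k)).
  have : ((c + k.+1%:R^-1)%:E * P (D k) <= c%:E * P (D k))%E.
    apply: le_trans (hB _ (mD k) (dD k)); rewrite iK//.
    have := @ge0_le_integral _ _ _ P (D k) (mD k) (cst (c + k.+1%:R^-1)%:E) (fun x => K x B).
    rewrite integral_cst//; apply => //.
    - by move=> x _; rewrite lee_fin addr_ge0// ltW.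
    - exact: measurable_funTS (mK _ mB).
  have : (0 <= P (D k))%E by [].
  rewrite -(fineK (fin_num_measure P _ (mD k))) -!EFinM !lee_fin.
  move: (fine _) => p p0 h; congr EFin; apply/eqP; rewrite eq_le p0 andbT leNgt.
  apply/negP => p1; have := mulr_gt0 k0 p1.
  by move: h; rewrite mulrDl; move: (_^-1 * p) (c * p) => a b; lra.
have : Q.-negligible (\bigcup_k D k).
  by apply: negligible_bigcup => k; exists (D k); split => //; exact: D0.
apply: negligibleS => x /= /negP; rewrite -ltNge => cx.
have [e e0 ce] : exists2 e, 0 < e & ((c + e)%:E <= K x B)%E.
  have mx : K x B \is a fin_num by exact: fin_num_measure.
  exists (fine (K x B) - c); first by rewrite subr_gt0 -lte_fin fineK.
  by rewrite addrC subrK fineK.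
exists (Num.truncn e^-1) => //; apply: le_trans ce; rewrite lee_fin lerD2l.
by rewrite -[leRHS]invrK lef_pV2 ?posrE ?invr_gt0// ltW// truncnS_gt.
Qed.

(** This is the upper bound for the complement of [B], with 1 - c in place of [c]. *)
Lemma rcd_ge (B : set T) (c : R) : measurable B -> c <= 1 ->
  (forall A, measurable A -> depends_only L A ->
     c%:E * P A <= P (A `&` g @^-1` B))%E ->
  {ae Q, forall x, (c%:E <= K x B)%E}.
Proof.
move=> mB c1 hB.
have mgB : measurable (g @^-1` B) by rewrite -[g @^-1` B]setTI; exact: mg.
have : {ae Q, forall x, (K x (~` B) <= (1 - c)%:E)%E}.
  apply: rcd_le; first exact: measurableC.
    by rewrite subr_ge0.
  move=> A mA dA; have mAB := measurableI _ _ mA mgB.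
  have mAC : measurable (A `&` g @^-1` (~` B)).
    by apply: measurableI => //; rewrite preimage_setC; exact: measurableC.
  have : P A = (P (A `&` g @^-1` (~` B)) + P (A `&` g @^-1` B))%E.
    by rewrite preimage_setC -setDE; exact: measureDI.
  have := hB A mA dA.
  rewrite -(fineK (fin_num_measure P _ mA)) -(fineK (fin_num_measure P _ mAB)).
  rewrite -(fineK (fin_num_measure P _ mAC)) -!EFinM -EFinD !lee_fin => h [e].
  by rewrite e in h *; lra.
apply: filterS => x; rewrite probability_setC//.
rewrite -(fineK (fin_num_measure (K x) _ mB)) -EFinB !lee_fin; lra.
Qed.

Lemma rcd_eq (B : set T) (c : R) : measurable B -> 0 <= c <= 1 ->
  (forall A, measurable A -> depends_only L A ->
     P (A `&` g @^-1` B) = c%:E * P A)%E ->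
  {ae Q, forall x, K x B = c%:E}.
Proof.
move=> mB /andP[c0 c1] hB.
have h1 : {ae Q, forall x, (K x B <= c%:E)%E}.
  by apply: rcd_le => // A mA dA; rewrite hB.
have h2 : {ae Q, forall x, (c%:E <= K x B)%E}.
  by apply: rcd_ge => // A mA dA; rewrite hB.
by apply: filterS2 h1 h2 => x ? ?; apply/eqP; rewrite eq_le; apply/andP.
Qed.

Lemma ae_forall_rat (p : rat -> n.-tuple R -> Prop) :
  (forall q, {ae Q, forall x, p q x}) -> {ae Q, forall x, forall q, p q x}.
Proof.
move=> h.
have : {ae Q, forall x, forall k, if unpickle k is Some q then p q x else True}.
  by apply: ae_foralln => k; case: unpickle => [q|]; [exact: h|exact: aeW].
by apply: filterS => x hx q; have := hx (pickle q); rewrite pickleK.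
Qed.

(** One null set serves all real levels: countably many rational ones are settled first, and
    monotonicity squeezes the others between them. *)
Lemma rcd_family (F : R -> set T) :
  (forall a, measurable (F a)) -> {homo F : a b / a <= b >-> a `<=` b} ->
  (forall (a : R) A, (0 <= a <= 1)%R -> measurable A -> depends_only L A ->
     P (A `&` g @^-1` F a) = a%:E * P A)%E ->
  {ae Q, forall x, forall a : R, 0 <= a <= 1 -> K x (F a) = a%:E}.
Proof.
move=> mF hF PF.
have : {ae Q, forall x, forall q : rat, 0 <= (ratr q : R) <= 1 ->
    K x (F (ratr q)) = (ratr q)%:E}.
  apply: ae_forall_rat => q; have [q01|nq] := boolP (0 <= (ratr q : R) <= 1).
    have : {ae Q, forall x, K x (F (ratr q)) = (ratr q)%:E}.
      by apply: rcd_eq => // A; exact: PF.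
    exact: filterS.
  exact: aeW.
apply: filterS => x hq a /andP[a0 a1].
have k0 : 0 <= fine (K x (F a)) by exact: fine_ge0.
have kE := fineK (fin_num_measure (K x) _ (mF a)).
have k1 : fine (K x (F a)) <= 1 by rewrite -lee_fin kE; exact: probability_le1.
have mono b c : b <= c -> (K x (F b) <= K x (F c))%E.
  by move=> bc; apply: le_measure; rewrite ?inE//; exact: hF.
rewrite -kE; congr EFin; apply/eqP; rewrite eq_le; apply/andP; split; rewrite leNgt;
  apply/negP => /rat_in_itvoo[q]; rewrite in_itv/= => /andP[q1 q2].
- have := mono a (ratr q) (ltW q1); rewrite hq; last by apply/andP; split; lra.
  by rewrite -kE lee_fin; lra.
- have := mono (ratr q) a (ltW q2); rewrite hq; last by apply/andP; split; lra.
  by rewrite -kE lee_fin; lra.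
Qed.

End ConditionalDistributions.

(** * Lipschitz conditional distribution functions *)

Section Continuity.
Context {R : realType}.

(** Only rational end points survive a countable union of null sets, and they suffice to make the
    distribution function Lipschitz with constant [c]. *)
Lemma cdf_continuous (P : probability R R) (c : R) :
  (forall p q : rat, (p <= q) ->
     (P `]ratr p, ratr q]%classic <= (c * (ratr q - ratr p))%:E)%E) ->
  continuous (Defs.cdf P).
Proof.
move=> hP.
have c0 : 0 <= c.
  have := hP 0 1 ler01; rewrite rmorph0 rmorph1 subr0 mulr1 -lee_fin.
  by apply: le_trans.
have mray (a : R) : measurable [set y : R | y <= a] by exact: measurable_le_ray.
have fray (a : R) : P [set y | y <= a] = (Defs.cdf P a)%:E.
  by rewrite /Defs.cdf fineK// fin_num_measure.
have inc a b : a <= b -> P `]a, b]%classic = (Defs.cdf P b - Defs.cdf P a)%:E.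
  move=> ab; rewrite EFinB -!fray.
  have -> : P [set y | y <= b] =
      (P (`]a, b]%classic : set R) + P [set y : R | (y <= a)%R])%E.
    rewrite -measureU//.
    - congr (P _); apply/seteqP; split => y /=; rewrite in_itv/=.
        by case: (leP y a) => [ya|ay]; [right|left].
      by case=> [/andP[]//|ya]; exact: le_trans ab.
    - by apply/seteqP; split => y //=; rewrite in_itv/= => -[/andP[/lt_le_trans h _] /h]; rewrite ltxx.
  by rewrite addeK// fin_num_measure.
have mono a b : a <= b -> Defs.cdf P a <= Defs.cdf P b.
  by move=> ab; rewrite -subr_ge0 -lee_fin -inc.
have lip a b : a <= b -> Defs.cdf P b - Defs.cdf P a <= c * (b - a).
  move=> ab; apply/ler_addgt0Pr => e e0.
  (* Widening the interval by [h] on both sides costs at most 2 c h, hence at most [e]; using c + 1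
     keeps the divisor positive. *)
  pose h := e / (2 * (c + 1)).
  have h0 : 0 < h by rewrite divr_gt0// mulr_gt0//; lra.
  have he : h * (2 * (c + 1)) = e by rewrite mulfVK// gt_eqF// mulr_gt0//; lra.
  have [p] : exists p : rat, ratr p \in `]a - h, a[ by apply: rat_in_itvoo; lra.
  rewrite in_itv/= => /andP[p1 p2].
  have [q] : exists q : rat, ratr q \in `]b, b + h[ by apply: rat_in_itvoo; lra.
  rewrite in_itv/= => /andP[q1 q2].
  have pq : ratr p <= ratr q :> R by lra.
  have := hP p q; rewrite -(ler_rat R) => /(_ pq); rewrite inc// lee_fin.
  have := mono _ _ (ltW p2); have := mono _ _ (ltW q1).
  have : c * (ratr q - ratr p) <= c * (b - a + 2 * h) by rewrite ler_wpM2l//; lra.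
  have : c * (b - a + 2 * h) <= c * (b - a) + e by nra.
  lra.
have lipn x y : `|Defs.cdf P x - Defs.cdf P y| <= c * `|x - y|.
  wlog yx : x y / y <= x => [hw|].
    by have [/hw//|/ltW/hw] := leP y x; rewrite distrC (distrC x).
  by rewrite !ger0_norm ?subr_ge0 ?lip ?mono.
have c1 : 0 < c + 1 by lra.
move=> x; apply/cvgrPdist_le => e e0.
have ec : 0 < e / (c + 1) by exact: divr_gt0.
near=> y; apply: le_trans (lipn _ _) _.
rewrite (@le_trans _ _ ((c + 1) * `|x - y|))//; first by rewrite ler_wpM2r//; lra.
rewrite mulrC -ler_pdivlMr//; near: y.
Unshelve. all: by end_near.
Qed.

(** Outside one null set, any version gives each rational interval at most twice its length, so its
    distribution function is Lipschitz with constant 2. *)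
Lemma parity_law_in_Cc n (T : {set 'I_n}) b : (1 < #|T|)%N ->
  in_Cc (@parity_law R n T b).
Proof.
move=> T1; split; first exact: copula_measure_parity_law.
move=> J L j _ _ _ _ /finset.setDP[_ jL] K rK.
have T0 : T != finset.set0 by rewrite -card_gt0; exact: ltnW.
have : {ae parity_law T b, forall x, forall p q : rat, p <= q ->
    (K x `]ratr p, ratr q]%classic <= (2 * (ratr q - ratr p))%:E)%E}.
  apply: ae_forall_rat => p; apply: ae_forall_rat => q.
  have [pq|] := boolP (p <= q); last by move=> _; exact: aeW.
  have pq' : ratr p <= ratr q :> R by rewrite ler_rat.
  suff : {ae parity_law T b, forall x,
      (K x `]ratr p, ratr q]%classic <= (2 * (ratr q - ratr p))%:E)%E}.
    exact: filterS.
  apply: (rcd_le rK (fun _ _ _ => erefl)).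
  - exact: measurable_itv.
  - by rewrite mulr_ge0// subr_ge0.
  - move=> A mA dA; have dA' : depends_only [set~ j]%SET A.
      apply: (depends_onlyS _ dA); apply/fintype.subsetP => m mL.
      by rewrite !inE; apply: contraNneq jL => <-.
    have -> : (fun x => tnth x j) @^-1` `]ratr p, ratr q]%classic =
        [set x : n.-tuple R | ratr p < tnth x j <= ratr q].
      by apply/seteqP; split => x /=; rewrite in_itv.
    exact: parity_law_itv.
apply: filterS => x hx; apply: (@cdf_continuous _ 2) => p q pq; exact: hx.
Qed.

End Continuity.

(** * Change of law in an integral, and the joint law of two coordinates *)

Section PairOfCoordinates.
Context {R : realType}.

(** This carries the integral defining a partial copula from the intermediate law to the original
    one, of which the conditional pair law is a version. *)
Lemma integral_dep n (P Q : probability (n.-tuple R) R) (L : {set 'I_n})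
    (f : n.-tuple R -> \bar R) :
  (forall A, measurable A -> depends_only L A -> P A = Q A) ->
  (forall x y, agree L x y -> f x = f y) -> measurable_fun setT f ->
  (forall x, 0 <= f x)%E ->
  (\int[P]_x f x = \int[Q]_x f x)%E.
Proof.
move=> PQ df mf f0.
have mk := @measurable_keep R _ L.
pose g := mfun_of mk.
have push (P0 : probability (n.-tuple R) R) :
    (\int[P0]_x f x = \int[pushforward P0 g]_x f x)%E.
  rewrite ge0_integral_pushforward// preimage_setT.
  by apply: eq_integral => x _; apply: df; exact: agree_keep.
rewrite !push; apply: eq_measure_integral => A mA _; apply: PQ.
  by have := mk measurableT A mA; rewrite setTI.
move=> x y xy; rewrite /preimage/=.
suff -> : keep L x = keep L y by [].
by apply: eq_from_tnth => i; rewrite !tnth_keep; case: ifP => // iL; exact: xy.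
Qed.

Lemma coordE n (x : n.-tuple R) i (h : (i < n)%N) : Defs.coord x i = tnth x (Ordinal h).
Proof. by rewrite /Defs.coord (tnth_nth 0). Qed.

Lemma coord_ord n (x : n.-tuple R) (i : 'I_n) : Defs.coord x i = tnth x i.
Proof. by rewrite /Defs.coord (tnth_nth 0). Qed.

Lemma orthant_pair2 (a b : R) : orthant (pair2 a b) =
  [set y : 2.-tuple R | Defs.coord y 0 <= a /\ Defs.coord y 1 <= b].
Proof.
apply/seteqP; split => y /=.
  by move=> h; split; [have := h ord0|have := h (lift ord0 ord0)];
    rewrite !(tnth_nth 0).
by move=> [h0 h1] m; rewrite !(tnth_nth 0); case: m => -[|[|]].
Qed.

Lemma pair2_eta (v : 2.-tuple R) : v = pair2 (Defs.coord v 0) (Defs.coord v 1).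
Proof.
by apply: eq_from_tnth => m; rewrite !(tnth_nth 0); case: m => -[|[|]].
Qed.

Definition proj2 n (i j : 'I_n) (x : n.-tuple R) : 2.-tuple R :=
  pair2 (tnth x i) (tnth x j).

Lemma measurable_proj2 n (i j : 'I_n) : measurable_fun setT (@proj2 n i j).
Proof.
apply/measurable_fun_tnthP => m.
rewrite (_ : _ \o _ = fun x => tnth x (if m == ord0 then i else j)).
  exact: measurable_tnth.
by apply/funext => x /=; rewrite (tnth_nth 0); case: m => -[|[|]].
Qed.

Lemma depends_only_proj2 n (L : {set 'I_n}) (i j : 'I_n) (B : set (2.-tuple R)) :
  i \in L -> j \in L -> depends_only L (proj2 i j @^-1` B).
Proof. by move=> iL jL x y xy; rewrite /preimage/= /proj2 !xy. Qed.

Lemma ucube_rays n (i j : 'I_n) (L : {set 'I_n}) (A : set (n.-tuple R)) (B C : set R) :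
  i != j -> i \notin L -> j \notin L -> measurable A -> depends_only L A ->
  measurable B -> measurable C ->
  ucube n (A `&` [set x | B (tnth x i)] `&` [set x | C (tnth x j)]) =
  (ucube n A * unif01 B * unif01 C)%E.
Proof.
move=> ij iL jL mA dA mB mC.
have sub k : k \notin L -> L \subset [set~ k]%SET.
  by move=> kL; apply/fintype.subsetP => m mL; rewrite !inE; apply: contraNneq kL => <-.
have mi := measurable_tnth_preim i mB.
rewrite (ucube_indep (j := j))//.
- by rewrite (ucube_indep (j := i))//; apply: depends_onlyS dA; exact: sub.
- exact: measurableI.
- apply: depends_onlyI; first by apply: (depends_onlyS _ dA); exact: sub.
  by apply: depends_only_coord; rewrite !inE.
Qed.

Lemma ucube_proj2 n (i j : 'I_n) (L : {set 'I_n}) (A : set (n.-tuple R))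
    (B : set (2.-tuple R)) :
  i != j -> i \notin L -> j \notin L -> measurable A -> depends_only L A ->
  measurable B ->
  ucube n (A `&` proj2 i j @^-1` B) = (ucube n A * ucube 2 B)%E.
Proof.
move=> ij iL jL mA dA mB.
have p0 : 0 <= fine (ucube n A) by exact: fine_ge0.
pose g := mfun_of (@measurable_proj2 n i j).
pose m2 := mscale (NngNum p0) (ucube 2).
pose m1 := pushforward (mrestr (ucube n) mA) g.
have <- : m2 B = (ucube n A * ucube 2 B)%E.
  by rewrite -[LHS]/((fine (ucube n A))%:E * ucube 2 B)%E fineK// fin_num_measure.
rewrite setIC -[LHS]/(m1 B).
apply: measure_eq_orthant => //.
  rewrite -[ltLHS]/(ucube n (setT `&` A)).
  by rewrite setTI (@le_lt_trans _ _ 1%E) ?ltry// probability_le1.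
move=> u.
rewrite -[LHS]/(ucube n (g @^-1` orthant u `&` A)).
rewrite -[RHS]/((fine (ucube n A))%:E * ucube 2 (orthant u))%E.
rewrite fineK ?fin_num_measure//.
have -> : g @^-1` orthant u `&` A =
    A `&` [set x | [set y | y <= Defs.coord u 0] (tnth x i)]
      `&` [set x | [set y | y <= Defs.coord u 1] (tnth x j)].
  rewrite [in orthant u](pair2_eta u) orthant_pair2; apply/seteqP; split => x /=.
    by move=> [[? ?] ?].
  by move=> [[? ?] ?].
rewrite (ucube_rays ij iL jL)//; try exact: measurable_le_ray.
have -> : orthant u = rect (fun m => [set y | y <= tnth u m]) by [].
rewrite ucubeE; last by move=> m; exact: measurable_le_ray.
rewrite !big_ord_recl big_ord0 mulr1 -muleA EFinM.
rewrite !fineK ?fin_num_measure//; try exact: measurable_le_ray.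
by rewrite !(tnth_nth 0).
Qed.

End PairOfCoordinates.

(** * Every partial vine copula of the parity law is the product copula *)

Section DVine.
Context {R : realType} (n : nat).
Hypothesis n3 : (2 < n)%N.

(** Indices start at 0, so these are the first, second and last coordinates, distinct because [n]
    exceeds 2. *)
Definition triple : {set 'I_n} := [set m : 'I_n | (m <= 1)%N || (m == n.-1 :> nat)]%SET.

Definition vine_law : probability (n.-tuple R) R := parity_law triple false.

Lemma triple_sub (L : {set 'I_n}) : triple \subset L ->
  [/\ exists2 m : 'I_n, m \in L & m = 0%N :> nat,
      exists2 m : 'I_n, m \in L & m = 1%N :> nat &
      exists2 m : 'I_n, m \in L & m = n.-1 :> nat].
Proof.
move=> /fintype.subsetP TL.
have h0 : (0 < n)%N by lia.
have h1 : (1 < n)%N by lia.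
have h2 : (n.-1 < n)%N by lia.
split; [exists (Ordinal h0)|exists (Ordinal h1)|exists (Ordinal h2)] => //;
  by apply: TL; rewrite inE ?eqxx ?orbT.
Qed.

Lemma card_triple : (1 < #|triple|)%N.
Proof.
have h0 : (0 < n)%N by lia.
have h1 : (1 < n)%N by lia.
apply/card_gt1P; exists (Ordinal h0), (Ordinal h1); rewrite !inE//.
Qed.

(** The condition on [i] and [k] says that the block misses the first or the last coordinate, both
    members of [triple]. *)
Lemma vine_law_blk i k (A : set (n.-tuple R)) :
  (0 < i)%N || (i + k < n.-1)%N -> measurable A -> depends_only (blk n i k) A ->
  vine_law A = ucube n A.
Proof.
move=> ik mA dA; apply: parity_law_dep dA => //.
apply/negP => /triple_sub[[m + m0] _ [l + lE]]; rewrite !inE m0 lE; lia.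
Qed.

Lemma vine_law_mid i k (A : set (n.-tuple R)) :
  measurable A -> depends_only (mid n i k) A -> vine_law A = ucube n A.
Proof.
move=> mA dA; apply: parity_law_dep dA => //.
by apply/negP => /triple_sub[[m + m0] _ _]; rewrite !inE m0; lia.
Qed.

Section Step.
Variables (i k : nat).
Hypotheses (k2 : (2 <= k)%N) (ikn : (i + k < n)%N).
Variables P P' : probability (n.-tuple R) R.
Hypothesis Pbox : forall u, in_cube u ->
  P (box (blk n i k.-1) u) = ucube n (box (blk n i k.-1) u).
Hypothesis P'box : forall u, in_cube u ->
  P' (box (blk n i.+1 k.-1) u) = ucube n (box (blk n i.+1 k.-1) u).

Let ltin : (i < n)%N. Proof. by lia. Qed.
Let a : 'I_n := Ordinal ltin.
Let b : 'I_n := Ordinal ikn.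

Let ab : a != b. Proof. by rewrite -val_eqE/=; lia. Qed.
Let amid : a \notin mid n i k. Proof. by rewrite inE/=; lia. Qed.
Let bmid : b \notin mid n i k. Proof. by rewrite inE/=; lia. Qed.

Let mid_blk : mid n i k \subset blk n i k.-1.
Proof. by apply/fintype.subsetP => m; rewrite !inE; lia. Qed.

Let mid_blk' : mid n i k \subset blk n i.+1 k.-1.
Proof. by apply/fintype.subsetP => m; rewrite !inE; lia. Qed.

Let in_mid (m : 'I_n) : m != a -> m != b -> (m \in mid n i k) = (m \in blk n i k).
Proof. by rewrite -!val_eqE !inE/=; lia. Qed.

Let a1 : a \in blk n i k.-1. Proof. by rewrite inE/=; lia. Qed.
Let b1 : b \in blk n i.+1 k.-1. Proof. by rewrite inE/=; lia. Qed.
Let a_blk : a \in blk n i k. Proof. by rewrite inE/=; lia. Qed.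
Let b_blk : b \in blk n i k. Proof. by rewrite inE/=; lia. Qed.

Let PU A : measurable A -> depends_only (blk n i k.-1) A -> P A = ucube n A.
Proof. by move=> mA dA; apply: (eq_ucube_dep Pbox). Qed.

Let P'U A : measurable A -> depends_only (blk n i.+1 k.-1) A -> P' A = ucube n A.
Proof. by move=> mA dA; apply: (eq_ucube_dep P'box). Qed.

Let PUmid A : measurable A -> depends_only (mid n i k) A -> P A = ucube n A.
Proof. by move=> mA dA; apply: PU => //; apply: depends_onlyS dA. Qed.

Let P'Umid A : measurable A -> depends_only (mid n i k) A -> P' A = ucube n A.
Proof. by move=> mA dA; apply: P'U => //; apply: depends_onlyS dA. Qed.

(* [Q] is one of [P], [P'] and the law [vine_law]; [c] is the coordinate [a]
   or [b], whose joint law with the coordinates in [mid n i k] is uniform. *)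
Let ray_indep (Q : probability (n.-tuple R) R) (c : 'I_n) (L : {set 'I_n}) r A :
  (forall B, measurable B -> depends_only L B -> Q B = ucube n B) ->
  c \in L -> mid n i k \subset L -> c \notin mid n i k ->
  0 <= r <= 1 -> measurable A -> depends_only (mid n i k) A ->
  Q (A `&` [set x | tnth x c <= r]) = (r%:E * Q A)%E.
Proof.
move=> QU cL mL cm r01 mA dA.
have mr := measurable_tnth_preim c (measurable_le_ray r).
have dL : depends_only L A by apply: depends_onlyS dA.
rewrite [in RHS]QU// QU; last 2 first.
- exact: measurableI.
- apply: depends_onlyI => //.
  by apply: (@depends_only_coord _ _ _ c [set y | y <= r]).
rewrite (@ucube_indep _ _ c A [set y | y <= r])//.
- by rewrite unif01_le// muleC.
- apply: depends_onlyS dA; apply/fintype.subsetP => m hm.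
  by rewrite !inE; apply: contraNneq cm => <-.
- exact: measurable_le_ray.
Qed.

Let ray_mono : {homo (fun r : R => [set y | y <= r]) : r s / r <= s >-> r `<=` s}.
Proof. by move=> r s rs y /= /le_trans; apply. Qed.

(** [P] and [P'] stand for the laws of the two overlapping shorter blocks, uniform by induction. All
    kernels are arbitrary versions, so the same lemma serves to identify every partial vine copula
    and to verify the recursion for an explicit one. *)
Lemma pvc_step (KL KR : n.-tuple R -> probability R R)
    (Kc Cc : n.-tuple R -> probability (2.-tuple R) R) :
  rcd P (mid n i k) (fun x => Defs.coord x i) KL ->
  rcd P' (mid n i k) (fun x => Defs.coord x (i + k)) KR ->
  rcd vine_law (mid n i k)
    (fun x => pair2 (Defs.coord x i) (Defs.coord x (i + k))) Kc ->
  (forall x y, agree (mid n i k) x y -> forall B, Cc x B = Cc y B) ->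
  (forall B, measurable B ->
     measurable_fun [set: n.-tuple R] (fun x => Cc x B : \bar R)) ->
  (forall x r s, Kc x (orthant (pair2 r s)) =
     Cc x (orthant (pair2
        (fine (Kc x [set y | Defs.coord y 0 <= r]))
        (fine (Kc x [set y | Defs.coord y 1 <= s]))))) ->
  let Cp r s := fine (\int[P]_x Cc x (orthant (pair2 r s)))%E in
  forall u, in_cube u ->
    (\int[P]_(x in box (mid n i k) u)
       (Cp (Defs.cdf (KL x) (Defs.coord u i))
           (Defs.cdf (KR x) (Defs.coord u (i + k))))%:E)%E =
    ucube n (box (blk n i k) u).
Proof.
move=> hL hR hc dC mC sklar Cp u uc.
have eL : (fun x : n.-tuple R => Defs.coord x i) = (fun x => tnth x a).
  by apply/funext => x; rewrite coordE.
have eR : (fun x : n.-tuple R => Defs.coord x (i + k)) = (fun x => tnth x b).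
  by apply/funext => x; rewrite coordE.
have ec : (fun x : n.-tuple R => pair2 (Defs.coord x i) (Defs.coord x (i + k))) =
    proj2 a b.
  by apply/funext => x; rewrite coordE (coordE _ ikn).
rewrite eL in hL; rewrite eR in hR; rewrite ec in hc.
have unifL : {ae P, forall x, forall r : R, 0 <= r <= 1 ->
    KL x [set y | y <= r] = r%:E}.
  apply: (rcd_family (@measurable_tnth _ _ _ a) hL (fun _ _ _ => erefl) _ ray_mono).
    exact: measurable_le_ray.
  by move=> r A r01 mA dA; exact: (ray_indep PU).
have unifR : {ae P, forall x, forall r : R, 0 <= r <= 1 ->
    KR x [set y | y <= r] = r%:E}.
  apply: (rcd_family (@measurable_tnth _ _ _ b) hR _ _ ray_mono).
  - by move=> A mA dA; rewrite PUmid ?P'Umid.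
  - exact: measurable_le_ray.
  - by move=> r A r01 mA dA; exact: (ray_indep P'U).
(* Dropping the right end of the block avoids the last coordinate; dropping the left end, in
   [vineU2], avoids the first. *)
have vineU1 : forall B, measurable B -> depends_only (blk n i k.-1) B ->
    vine_law B = ucube n B.
  by move=> B mB dB; apply: vine_law_blk dB => //; clear -n3 k2 ikn; lia.
have vineU2 : forall B, measurable B -> depends_only (blk n i.+1 k.-1) B ->
    vine_law B = ucube n B.
  by move=> B mB dB; apply: vine_law_blk dB => //; clear -n3 k2 ikn; lia.
have mray2 (m : 'I_2) (r : R) : measurable [set y : 2.-tuple R | Defs.coord y m <= r].
  rewrite (_ : [set _ | _] = [set y | [set z | z <= r] (tnth y m)]).
    exact: (measurable_tnth_preim m (measurable_le_ray r)).
  by apply/seteqP; split => y /=; rewrite coord_ord.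
have unif0 : {ae vine_law, forall x, forall r : R, 0 <= r <= 1 ->
    Kc x [set y | Defs.coord y 0 <= r] = r%:E}.
  apply: (rcd_family (@measurable_proj2 _ _ a b) hc (fun _ _ _ => erefl)
    (F := fun r => [set y | Defs.coord y 0 <= r])).
  - exact: (mray2 ord0).
  - by move=> r s rs y /= /le_trans; apply.
  - by move=> r A r01 mA dA; apply: (ray_indep vineU1).
have unif1 : {ae vine_law, forall x, forall r : R, 0 <= r <= 1 ->
    Kc x [set y | Defs.coord y 1 <= r] = r%:E}.
  apply: (rcd_family (@measurable_proj2 _ _ a b) hc (fun _ _ _ => erefl)
    (F := fun r => [set y | Defs.coord y 1 <= r])).
  - exact: (mray2 ord_max).
  - by move=> r s rs y /= /le_trans; apply.
  - by move=> r A r01 mA dA; apply: (ray_indep vineU2).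
have CpE r s : 0 <= r <= 1 -> 0 <= s <= 1 -> Cp r s = r * s.
  move=> r01 s01; have mO := measurable_orthant (pair2 r s).
  have [_ mK iK] := hc.
  suff : (\int[P]_x Cc x (orthant (pair2 r s)) = (r * s)%:E)%E by rewrite /Cp => ->.
  (* [Kc] is a version under [vine_law], not under [P]; both laws are uniform on the middle
     coordinates. *)
  rewrite (@integral_dep _ _ P vine_law (mid n i k)) //; last 3 first.
  - by move=> A mA dA; rewrite PUmid// (vine_law_mid _ dA).
  - by move=> x y xy; exact: dC.
  - exact: mC.
  transitivity (\int[vine_law]_x Kc x (orthant (pair2 r s)))%E.
    apply: ae_eq_integral => //; [exact: mC|exact: mK|].
    by apply: filterS2 unif0 unif1 => x h0 h1 _; rewrite sklar h0// h1.
  rewrite -iK// setTI.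
  have eO : proj2 a b @^-1` orthant (pair2 r s) =
      setT `&` [set x | [set z | z <= r] (tnth x a)]
           `&` [set x | [set z | z <= s] (tnth x b)].
    by rewrite orthant_pair2; apply/seteqP; split => x /=; [move=> []|move=> [[_ ?] ?]].
  transitivity (ucube n (proj2 a b @^-1` orthant (pair2 r s))).
    apply: (@parity_law_dep _ _ _ [set a; b]%SET).
    - apply/negP => /triple_sub[[m0 + e0] [m1 + e1] [m2 + e2]].
      by rewrite !inE -!val_eqE/= e0 e1 e2; clear -n3 k2 ikn; lia.
    - by have := measurable_proj2 a b measurableT mO; rewrite setTI.
    - by apply: depends_only_proj2; rewrite !inE eqxx ?orbT.
  rewrite eO (@ucube_rays _ _ a b finset.set0)//; try exact: measurable_le_ray.
  - by rewrite probability_setT mul1e !unif01_le.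
  - by rewrite inE.
  - by rewrite inE.
have ua : 0 <= Defs.coord u i <= 1 by rewrite coordE.
have ub : 0 <= Defs.coord u (i + k) <= 1 by rewrite coordE.
have cdf01 (Q : probability R R) r : 0 <= Defs.cdf Q r <= 1.
  rewrite /Defs.cdf fine_ge0//= -lee_fin fineK ?probability_le1//.
    exact: measurable_le_ray.
  exact: (fin_num_measure Q _ (measurable_le_ray r)).
have mB := measurable_box (mid n i k) u.
have mcdf (Q : n.-tuple R -> probability R R) r :
    (forall B, measurable B -> measurable_fun [set: n.-tuple R] (fun x => Q x B : \bar R)) ->
    measurable_fun setT (fun x => Defs.cdf (Q x) r).
  move=> mQ; apply: measurableT_comp; first exact: fine_measurable.
  by apply: mQ; exact: measurable_le_ray.
transitivity (\int[P]_(x in box (mid n i k) u)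
    (Defs.coord u i * Defs.coord u (i + k))%:E)%E.
  apply: ae_eq_integral => //.
  (* The product form of [Cp] holds at every [x], as distribution functions take values in [0,1]; it
     supplies measurability of the integrand. *)
  - rewrite (_ : (fun x => _) = fun x => (Defs.cdf (KL x) (Defs.coord u i) *
        Defs.cdf (KR x) (Defs.coord u (i + k)))%:E); last first.
      by apply/funext => x; rewrite CpE.
    apply/measurable_EFinP; apply: measurable_funTS; apply: measurable_funM;
      apply: mcdf; [by case: hL|by case: hR].
  - apply: filterS2 unifL unifR => x hx hy _; rewrite CpE// /Defs.cdf.
    by rewrite hx// hy.
rewrite (integral_cst P mB (Defs.coord u i * Defs.coord u (i + k))%:E).
rewrite [X in (_ * X)%E]PUmid//; last exact: depends_only_box.
have -> : box (blk n i k) u = box (mid n i k) u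
    `&` [set x | [set z | z <= Defs.coord u i] (tnth x a)]
    `&` [set x | [set z | z <= Defs.coord u (i + k)] (tnth x b)].
  rewrite (coordE u ltin) (coordE u ikn); apply/seteqP; split => x.
    move=> h; split; [split => [m hm|]|]; [|exact: h|exact: h].
    by apply: h; rewrite -in_mid//; [move: amid|move: bmid]; apply: contraNneq => <-.
  move=> [[h ha] hb] m hm.
  have [->|ma] := eqVneq m a; first exact: ha.
  have [->|mb] := eqVneq m b; first exact: hb.
  by apply: h; rewrite in_mid.
rewrite (ucube_rays ab amid bmid)//; try exact: measurable_le_ray.
- by rewrite !unif01_le// EFinM muleC muleA.
- exact: depends_only_box.
Qed.

End Step.

(** Induction on the block length, for all positions at once; adjacent pairs are uniform since they
    cannot contain [triple]. *)
Lemma pvc_ucube (nu : probability (n.-tuple R) R) : is_PVC vine_law nu ->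
  forall u, in_cube u -> nu (orthant u) = ucube n (orthant u).
Proof.
move=> [P [P1 Pk _ nuE]] u uc.
have blkU k : (0 < k)%N -> forall i, (i + k < n)%N -> forall v, in_cube v ->
    P i k (box (blk n i k) v) = ucube n (box (blk n i k) v).
  elim: k => // -[_ _ i ikn v vc|k IH _ i ikn v vc].
    rewrite P1; last by lia.
    apply: (@parity_law_dep _ _ _ (blk n i 1)).
    - apply/negP => /triple_sub[[m0 + e0] [m1 + e1] [m2 + e2]].
      by rewrite !inE e0 e1 e2; lia.
    - exact: measurable_box.
    - exact: depends_only_box.
  have [//|//|KL [KR [Kc [Cc [hL hR hc [_ [dC [mC sk]]] ->//]]]]] := Pk i k.+2.
  apply: (pvc_step _ _ _ _ hL hR hc) => //.
  - by move=> w wc; apply: IH => //; lia.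
  - by move=> w wc; apply: IH => //; lia.
rewrite nuE//; have blkT : blk n 0 n.-1 = [set: 'I_n]%SET.
  by apply/setP => m; rewrite !inE; have := ltn_ord m; lia.
by rewrite -blkT blkU ?blkT ?box_setT//; lia.
Qed.

End DVine.

(** * Sklar's identity for a copula and its own margins *)

Section Sklar.
Context {R : realType}.

(** The difference of [A'] and [A] is null. This allows a threshold to be exchanged for another one
    at which the margin takes the same value. *)
Lemma measureI_nested {d} {T : measurableType d} (Q : probability T R)
    (A A' B : set T) :
  measurable A -> measurable A' -> measurable B -> A `<=` A' -> Q A = Q A' ->
  Q (A `&` B) = Q (A' `&` B).
Proof.
move=> mA mA' mB AA' QA.
have mD : measurable (A' `\` A) by exact: measurableD.
have D0 : Q (A' `\` A) = 0%E.
  have : Q A' = (Q (A' `\` A) + Q (A' `&` A))%E by exact: measureDI.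
  rewrite setIidr// -QA -(fineK (fin_num_measure Q _ mA)).
  by rewrite -(fineK (fin_num_measure Q _ mD)) -EFinD => -[e]; congr EFin; lra.
have mAB := measurableI _ _ mA mB; have mAB' := measurableI _ _ mA' mB.
apply/eqP; rewrite eq_le; apply/andP; split.
  by apply: le_measure; rewrite ?inE//; exact: setSI.
rewrite -[leRHS]add0e -D0.
apply: (@le_trans _ _ (Q ((A' `\` A) `|` (A `&` B)))).
  apply: le_measure; rewrite ?inE//; first exact: measurableU.
  by move=> x [? ?]; have [?|?] := pselect (A x); [right|left].
exact: measureU2.
Qed.

(* Evaluating a copula at its own margins changes nothing, even outside the
   unit square: this gives Sklar's identity with conditional law and
   conditional copula equal. *)
Lemma copula_sklar (Q : probability (2.-tuple R) R) r s : copula_measure Q ->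
  Q (orthant (pair2 r s)) =
  Q (orthant (pair2 (fine (Q [set y | Defs.coord y 0 <= r]))
                    (fine (Q [set y | Defs.coord y 1 <= s])))).
Proof.
move=> cQ; pose F (m : 'I_2) t := [set y : 2.-tuple R | Defs.coord y m <= t].
have mF m t : measurable (F m t).
  rewrite (_ : F m t = [set y | [set z | z <= t] (tnth y m)]).
    exact: (measurable_tnth_preim m (measurable_le_ray t)).
  by apply/seteqP; split => y; rewrite /F/= coord_ord.
have QF m t : 0 <= t <= 1 -> Q (F m t) = t%:E.
  move=> t01; rewrite -(cQ m t t01); congr (Q _).
  by apply/seteqP; split => y; rewrite /F/= coord_ord.
have QFF m t : Q (F m (fine (Q (F m t)))) = Q (F m t).
  have fQ := fin_num_measure Q _ (mF m t).
  by rewrite QF ?fineK// fine_ge0//= -lee_fin fineK// probability_le1.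
have swap m t B : measurable B ->
    Q (F m t `&` B) = Q (F m (fine (Q (F m t))) `&` B).
  move=> mB; have [h|h] := leP t (fine (Q (F m t))).
    apply: (measureI_nested (mF m t) (mF m _) mB _ (esym (QFF m t))).
    by move=> y; rewrite /F/= => /le_trans; apply.
  apply: esym; apply: (measureI_nested (mF m _) (mF m t) mB _ (QFF m t)).
  by move=> y; rewrite /F/= => /le_trans; apply; exact: ltW.
have O a b : orthant (pair2 a b) = F ord0 a `&` F ord_max b.
  by rewrite orthant_pair2.
by rewrite !O (swap ord0 r _ (mF _ _)) [in LHS]setIC [in RHS]setIC; exact: swap.
Qed.

End Sklar.

(** * Existence of a partial vine copula, and the gap *)

Section Existence.
Context {R : realType} (n : nat).
Hypothesis n3 : (2 < n)%N.

Lemma rcd_unif01 i k (c : 'I_n) : c \notin mid n i k ->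
  rcd (ucube n) (mid n i k) (fun x : n.-tuple R => tnth x c) (cst unif01).
Proof.
move=> cm; split => //.
move=> A B mA dA mB; rewrite (integral_cst (ucube n) mA (unif01 B)).
rewrite [LHS](@ucube_indep _ _ c A B)//; first by rewrite muleC.
by apply: depends_onlyS dA; apply/fintype.subsetP => m hm;
  rewrite !inE; apply: contraNneq cm => <-.
Qed.

Let lt1n : (1 < n)%N. Proof. exact: ltnW. Qed.
Let lt0n : (0 < n)%N. Proof. exact: ltnW. Qed.
Let ltpn : (n.-1 < n)%N. Proof. by lia. Qed.
Let one : 'I_n := Ordinal lt1n.
Let zero : 'I_n := Ordinal lt0n.
Let end_ : 'I_n := Ordinal ltpn.

Lemma tripleE : triple n = [set zero; one; end_]%SET.
Proof.
apply/setP => m; rewrite !inE -!val_eqE/=.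
by case: (m : nat) => [|[|k]].
Qed.

Lemma card_triple3 : #|triple n| = 3.
Proof.
rewrite tripleE finset.setUC cardsU1 cards2 !inE -!val_eqE/=; move: n3; clear; lia.
Qed.

(** Once the second coordinate is known, the condition on the outer two is again a parity condition,
    with a flag. *)
Lemma par_triple (x : n.-tuple R) :
  par (triple n) x = (tnth x one <= 1 / 2) (+) par [set: 'I_2]%SET (proj2 zero end_ x).
Proof.
have oT : one \in triple n by rewrite inE.
have zT : zero \in (triple n :\ one)%SET by rewrite !inE -val_eqE.
have eT : end_ \in (triple n :\ one :\ zero)%SET.
  by rewrite !inE -!val_eqE/= eqxx orbT; move: n3; clear; lia.
have T0 : (triple n :\ one :\ zero :\ end_)%SET = finset.set0.
  by apply/setP => m; rewrite tripleE !inE; case: (m == one); case: (m == zero);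
    case: (m == end_).
rewrite (parD1 _ oT) (parD1 _ zT) (parD1 _ eT) T0 par0; congr (_ (+) _).
have m2 : ord_max \in ([set: 'I_2] :\ ord0)%SET by rewrite !inE.
have S0 : ([set: 'I_2] :\ ord0 :\ ord_max)%SET = finset.set0.
  by apply/setP => m; rewrite !inE; case: m => -[|[|]].
rewrite (parD1 _ (finset.in_setT ord0)) (parD1 _ m2) S0 par0.
have -> : tnth (proj2 zero end_ x) ord0 = tnth x zero by [].
by have -> : tnth (proj2 zero end_ x) ord_max = tnth x end_ by rewrite (tnth_nth 0).
Qed.

(** Only the outermost pair together with its middle contains [triple]. A low second coordinate
    requires an even count in that pair, hence the flag. Its margins being uniform, this kernel
    serves as both conditional law and conditional copula. *)
Definition cond_law (i k : nat) (x : n.-tuple R) : probability (2.-tuple R) R :=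
  if (i == 0%N) && (k == n.-1) then parity_law [set: 'I_2]%SET (tnth x one <= 1 / 2)
  else ucube 2.

Let card2 : (1 < #|[set: 'I_2]%SET|)%N. Proof. by rewrite cardsT card_ord. Qed.

Let set2_neq0 : [set: 'I_2]%SET != finset.set0.
Proof. by rewrite -card_gt0 ltnW. Qed.

Lemma copula_measure_cond_law i k x : copula_measure (cond_law i k x).
Proof.
rewrite /cond_law; case: ifP => _; first exact: copula_measure_parity_law.
exact: copula_measure_ucube.
Qed.

Lemma cond_law_agree i k x y : agree (mid n i k) x y ->
  forall B, cond_law i k x B = cond_law i k y B.
Proof.
move=> xy B; rewrite /cond_law; case: ifP => // /andP[/eqP i0 /eqP kn].
by rewrite xy// inE i0 kn/=; move: n3; clear; lia.
Qed.

Lemma measurable_cond_law i k B : measurable B ->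
  measurable_fun [set: n.-tuple R] (fun x => cond_law i k x B : \bar R).
Proof.
move=> mB.
have -> : (fun x : n.-tuple R => cond_law i k x B : \bar R) =
    if (i == 0%N) && (k == n.-1) then
      (fun x => if tnth x one <= 1 / 2 then parity_law [set: 'I_2]%SET true B
                else parity_law [set: 'I_2]%SET false B)
    else cst (ucube 2 B).
  apply/funext => x; rewrite /cond_law; case: ifP => // _.
  by case: (tnth x one <= 1 / 2).
case: ifP => _; last exact: measurable_cst.
apply: measurable_fun_ifT; [|exact: measurable_cst|exact: measurable_cst].
by apply: measurable_fun_ler; [exact: measurable_tnth|exact: measurable_cst].
Qed.

(** Cutting [A] at the second coordinate fixes the flag on each half. There the uniform law
    factorises into middle and pair, and the density factor 2 of the vine law becomes that of the
    pair law. *)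
Lemma rcd_cond_law_top : rcd (@vine_law R n) (mid n 0 n.-1) (proj2 zero end_)
  (cond_law 0 n.-1).
Proof.
split; first exact: cond_law_agree.
  by move=> B; exact: measurable_cond_law.
move=> A B mA dA mB.
pose lo := @low R n one.
have mlo : measurable lo by exact: measurable_low.
have mAl := measurableI _ _ mA mlo.
have mAh := measurableI _ _ mA (measurableC mlo).
have one_mid : one \in mid n 0 n.-1 by rewrite inE/=; move: n3; clear; lia.
have dlo : depends_only (mid n 0 n.-1) lo.
  exact: (@depends_only_coord _ _ _ one [set y | y <= 1 / 2]).
have dhi : depends_only (mid n 0 n.-1) (~` lo).
  by move=> x y xy; split => h /(dlo _ _ xy).
have ze : zero != end_ by rewrite -val_eqE/=; move: n3; clear; lia.
have zm : zero \notin mid n 0 n.-1 by rewrite inE.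
have em : end_ \notin mid n 0 n.-1 by rewrite inE/= ltnn andbF.
pose S (c : bool) : set (2.-tuple R) := B `&` parity_set [set: 'I_2]%SET c.
have mS c : measurable (S c).
  by apply: measurableI => //; exact: measurable_parity_set.
have mgS c : measurable (proj2 zero end_ @^-1` S c).
  by have := measurable_proj2 zero end_ measurableT (mS c); rewrite setTI.
have T0 : triple n != finset.set0 by rewrite -card_gt0 card_triple3.
rewrite parity_lawE//.
have -> : A `&` proj2 zero end_ @^-1` B `&` parity_set (triple n) false =
    (A `&` lo `&` proj2 zero end_ @^-1` S true) `|`
    (A `&` ~` lo `&` proj2 zero end_ @^-1` S false).
  apply/seteqP; split => x; rewrite /S /lo /low /parity_set/= par_triple.
    move=> [[Ax Bx]]; case: (boolP (_ <= _)) => [h|/negP h] p; [left|right].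
    by split; [split|split => //=; move: p; case: par].
  by split; [split => // /h|split => //=; move: p; case: par].
move=> [[[Ax h] [Bx p]]|[[Ax /negP h] [Bx p]]]; split => //.
    by rewrite h; move: p => /=; case: par.
  by rewrite (negPf h); move: p => /=; case: par.
transitivity ((ucube n (A `&` lo `&` proj2 zero end_ @^-1` S true) +
    ucube n (A `&` ~` lo `&` proj2 zero end_ @^-1` S false)) * 2%:E)%E.
  congr (_ * _)%E; apply: measureU.
  - exact: measurableI.
  - exact: measurableI.
  - by apply/seteqP; split => // x [[[_ h] _] [[_ /(_ h)]]].
rewrite (ucube_proj2 ze zm em mAl (depends_onlyI dA dlo) (mS true)).
rewrite (ucube_proj2 ze zm em mAh (depends_onlyI dA dhi) (mS false)).
have Aun : A = (A `&` lo) `|` (A `&` ~` lo) by rewrite -setIUr setUv setIT.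
rewrite [in RHS]Aun ge0_integral_setU//; last 2 first.
- exact: measurable_funTS (measurable_cond_law _ _ mB).
- by apply/disj_setPS => x [[_ h] [_ /(_ h)]].
have topE (x : n.-tuple R) : cond_law 0 n.-1 x B =
    parity_law [set: 'I_2]%SET (tnth x one <= 1 / 2) B.
  by rewrite /cond_law !eqxx.
transitivity (\int[vine_law n]_(x in A `&` lo) cst (ucube 2 (S true) * 2%:E) x +
    \int[vine_law n]_(x in A `&` ~` lo) cst (ucube 2 (S false) * 2%:E) x)%E.
  rewrite (integral_cst (vine_law n) mAl) (integral_cst (vine_law n) mAh).
  have el : vine_law n (A `&` lo) = ucube n (A `&` lo).
    exact: (vine_law_mid n3 mAl (depends_onlyI dA dlo)).
  have eh : vine_law n (A `&` ~` lo) = ucube n (A `&` ~` lo).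
    exact: (vine_law_mid n3 mAh (depends_onlyI dA dhi)).
  rewrite [X in (_ = _ * X + _)%E]el [X in (_ = _ + _ * X)%E]eh.
  rewrite -(fineK (fin_num_measure (ucube n) _ mAl)).
  rewrite -(fineK (fin_num_measure (ucube n) _ mAh)).
  rewrite -(fineK (fin_num_measure (ucube 2) _ (mS true))).
  rewrite -(fineK (fin_num_measure (ucube 2) _ (mS false))).
  by rewrite -!EFinM -!EFinD; congr EFin; lra.
congr (_ + _)%E; apply: eq_integral => x; rewrite inE => -[_ h]; rewrite topE.
  by rewrite (_ : _ <= _ = true) ?parity_lawE.
by rewrite (_ : _ <= _ = false) ?parity_lawE//; apply/negbTE/negP.
Qed.

Lemma rcd_cond_law i k (a b : 'I_n) : (2 <= k)%N -> (i + k < n)%N ->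
  a = i :> nat -> b = (i + k)%N :> nat ->
  rcd (@vine_law R n) (mid n i k) (proj2 a b) (cond_law i k).
Proof.
move=> k2 ikn ai bk.
have [/andP[/eqP i0 /eqP kn]|top] := boolP ((i == 0%N) && (k == n.-1)).
  move: ai bk; rewrite i0 kn => ai bk.
  have -> : a = zero by apply: val_inj; exact: ai.
  have -> : b = end_ by apply: val_inj; exact: bk.
  exact: rcd_cond_law_top.
split; first exact: cond_law_agree.
  by move=> B; exact: measurable_cond_law.
move=> A B mA dA mB; rewrite /cond_law (negPf top).
have mgB : measurable (proj2 a b @^-1` B).
  by have := measurable_proj2 a b measurableT mB; rewrite setTI.
rewrite (integral_cst (vine_law n) mA).
rewrite [X in (_ * X)%E](vine_law_mid n3 mA dA).
rewrite (@vine_law_blk _ n n3 i k); last 3 first.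
- by move: top ikn; clear; lia.
- exact: measurableI.
- apply: depends_onlyI.
    apply: depends_onlyS dA; apply/fintype.subsetP => m; rewrite !inE; clear; lia.
  by apply: depends_only_proj2; rewrite inE ?ai ?bk; clear; lia.
have ab : a != b by rewrite -val_eqE/= ai bk; move: k2; clear; lia.
have am : a \notin mid n i k by rewrite inE ai ltnn.
have bm : b \notin mid n i k by rewrite inE bk ltnn andbF.
by rewrite (ucube_proj2 ab am bm mA dA mB) muleC.
Qed.

(** All intermediate laws are taken to be [ucube n], so the hypotheses of [pvc_step] on shorter
    blocks hold trivially. *)
Lemma is_PVC_ucube : is_PVC (@vine_law R n) (ucube n).
Proof.
exists (fun _ _ => ucube n); split.
- move=> i i1n u; apply: esym; apply: (@parity_law_dep _ _ _ (blk n i 1)).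
  + apply/negP => /(triple_sub n3)[[m0 + e0] [m1 + e1] [m2 + e2]].
    by rewrite !inE e0 e1 e2; move: n3; clear; lia.
  + exact: measurable_box.
  + exact: depends_only_box.
- move=> i k k2 ikn.
  have ltin : (i < n)%N by move: ikn; clear; lia.
  pose a := Ordinal ltin; pose b := Ordinal ikn.
  have eL : (fun x : n.-tuple R => Defs.coord x i) = (fun x => tnth x a).
    by apply/funext => x; rewrite coordE.
  have eR : (fun x : n.-tuple R => Defs.coord x (i + k)) = (fun x => tnth x b).
    by apply/funext => x; rewrite coordE.
  have ec : (fun x : n.-tuple R => pair2 (Defs.coord x i) (Defs.coord x (i + k))) =
      proj2 a b.
    by apply/funext => x; rewrite (coordE x ltin) (coordE x ikn).
  exists (cst unif01), (cst unif01), (cond_law i k), (cond_law i k).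
  have hL : rcd (ucube n) (mid n i k) (fun x : n.-tuple R => Defs.coord x i) (cst unif01).
    by rewrite eL; apply: rcd_unif01; rewrite inE ltnn.
  have hR : rcd (ucube n) (mid n i k) (fun x : n.-tuple R => Defs.coord x (i + k)) (cst unif01).
    by rewrite eR; apply: rcd_unif01; rewrite inE/= ltnn andbF.
  have hc : rcd (@vine_law R n) (mid n i k)
      (fun x => pair2 (Defs.coord x i) (Defs.coord x (i + k))) (cond_law i k).
    by rewrite ec; exact: rcd_cond_law.
  have sk x r s := copula_sklar r s (copula_measure_cond_law i k x).
  split => //.
  + split; first by move=> x; exact: copula_measure_cond_law.
    split; first by move=> x y xy; exact: cond_law_agree.
    by split => // B; exact: measurable_cond_law.
  + move=> Cp u uc; apply: esym.
    apply: (pvc_step n3 k2 ikn _ _ hL hR hc) => //.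
    * by move=> x y xy; exact: cond_law_agree.
    * by move=> B; exact: measurable_cond_law.
- exact: copula_measure_ucube.
- by move=> u uc; rewrite box_setT.
Qed.

Lemma vine_law_gap (nu : probability (n.-tuple R) R) : is_PVC (@vine_law R n) nu ->
  exists u, in_cube u /\ `|copula_of (@vine_law R n) u - copula_of nu u| = 1 / 8.
Proof.
move=> nuP; pose u : n.-tuple R := [tuple if m \in triple n then 1 / 2 else 1 | m < n].
have uc : in_cube u by move=> m; rewrite tnth_mktuple; case: ifP => _; lra.
exists u; split => //.
have mO := measurable_orthant u.
have Uu : ucube n (orthant u) = (1 / 8)%:E.
  rewrite -box_setT ucube_box//; congr EFin.
  under eq_bigr do rewrite tnth_mktuple.
  rewrite (eq_bigl xpredT); last by move=> m; rewrite inE.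
  rewrite -big_mkcond/= prodr_const card_triple3; lra.
have T0 : triple n != finset.set0 by rewrite -card_gt0 card_triple3.
rewrite /copula_of (pvc_ucube n3 nuP uc) parity_lawE//.
(* All three parity coordinates are low throughout the orthant and three is odd, so it lies in the
   parity set and its mass 1/8 is doubled. *)
rewrite (_ : _ `&` _ = orthant u) ?Uu/=.
  by rewrite ger0_norm; lra.
apply/seteqP; split => [x []//|x h]; split => //.
rewrite /parity_set/= addbF /par.
rewrite (_ : [set m in _ | _]%SET = triple n) ?card_triple3//.
apply/setP => m; rewrite inE; have [mT|] := boolP (m \in triple n) => //=.
by have := h m; rewrite tnth_mktuple mT.
Qed.

End Existence.

(** * Bounds on the uniform distance *)

Section UniformDistance.
Context {R : realType} {n : nat}.
Variables Q1 Q2 : probability (n.-tuple R) R.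

Lemma copula_of_bounds (Q : probability (n.-tuple R) R) u : 0 <= copula_of Q u <= 1.
Proof.
have mO := measurable_orthant u.
by rewrite /copula_of fine_ge0//= -lee_fin fineK ?probability_le1// fin_num_measure.
Qed.

Lemma copula_of_dist u : `|copula_of Q1 u - copula_of Q2 u| <= 1.
Proof.
have /andP[a0 a1] := copula_of_bounds Q1 u; have /andP[b0 b1] := copula_of_bounds Q2 u.
by rewrite ler_norml; apply/andP; split; lra.
Qed.

(** A real [sup] dominates its members only for a set bounded above; copula values in [0,1] give the
    bound 1. *)
Lemma dinf_ge u : in_cube u -> `|copula_of Q1 u - copula_of Q2 u| <= dinf Q1 Q2.
Proof.
move=> uc; apply: ub_le_sup; last by exists u.
by exists 1 => _ [v [_ ->]]; exact: copula_of_dist.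
Qed.

(** This provides the upper bound that the outer supremum over all copulas requires. *)
Lemma dinf_le1 : dinf Q1 Q2 <= 1.
Proof.
apply: ge_sup; last by move=> _ [v [_ ->]]; exact: copula_of_dist.
exists `|copula_of Q1 [tuple 0 | i < n] - copula_of Q2 [tuple 0 | i < n]|.
by exists [tuple 0 | i < n]; split => // m; rewrite tnth_mktuple lexx ler01.
Qed.

End UniformDistance.

Theorem theorem7p6 (R : realType) (d : nat) : (3 <= d)%N ->
  (exists mu : probability (d.-tuple R) R,
     [/\ in_Cc mu,
         exists nu, is_PVC mu nu &
         forall nu, is_PVC mu nu -> 1 / 8 <= dinf mu nu]) /\
  1 / 8 <= sup [set r : R | exists mu nu : probability (d.-tuple R) R,
                  [/\ in_Cc mu, is_PVC mu nu & r = dinf mu nu]].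
Proof.
move=> d3.
have Cc : in_Cc (@vine_law R d) by apply: parity_law_in_Cc; exact: card_triple.
have pvc := @is_PVC_ucube R d d3.
have gap (nu : probability (d.-tuple R) R) : is_PVC (@vine_law R d) nu ->
    1 / 8 <= dinf (@vine_law R d) nu.
  by move=> /(vine_law_gap d3)[u [uc <-]]; exact: dinf_ge.
split.
  by exists (@vine_law R d); split => //; exists (ucube d).
apply: (le_trans (gap _ pvc)); apply: ub_le_sup.
  by exists 1 => _ [mu [nu [_ _ ->]]]; exact: dinf_le1.
by exists (@vine_law R d), (ucube d).
Qed.
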